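(* Let $g\ge 2$. Let $\Gamma$ be a tropical curve of genus $g$, let $D$ be a divisor on $\Gamma$ of nonnegative rank, and suppose that $p$ is an isolated point of $\operatorname{WL}(D)$. (1) If $D=K$ is the canonical divisor of $\Gamma$, then $\operatorname{wt}_K(p)\le g-1$. (2) If $\deg D>2g-2$, then $\operatorname{wt}_D(p)\le g$. (3) The bounds in (1) and (2) are optimal in the following sense: for (1), there exist a tropical curve $\Gamma$ of genus $g$ and a point $p\in\Gamma$, isolated in $\operatorname{WL}(K)$, with $\operatorname{wt}_K(p)=g-1$; for (2), for each integer $d>2g-2$ there exist a tropical curve $\Gamma$ of genus $g$, a divisor $D\in\operatorname{Div}(\Gamma)$ of degree $d$ and nonnegative rank, and a point $p\in\Gamma$, isolated in $\operatorname{WL}(D)$, with $\operatorname{wt}_D(p)=g$.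
   Context: A tropical curve (metric graph) $\Gamma$ is a compact connected metric space with the path metric in which every point $p$ has an open neighborhood isometric to a star with $m=\operatorname{val}(p)\ge 1$ branches of some radius $\varepsilon>0$ centered at $p$ (equivalently, it is obtained from a finite connected graph with positive edge lengths). Its genus is $\dim_{\mathbb R}H_1(\Gamma,\mathbb R)$. $T_p\Gamma$ is the set of outgoing tangent directions at $p$. $\operatorname{Div}(\Gamma)$ is the free abelian group on the points of $\Gamma$; $D=\sum_p D(p)(p)$, $\deg D=\sum_p D(p)$, and $D$ is effective if all $D(p)\ge 0$. A rational function is a continuous piecewise affine function $f:\Gamma\to\mathbb R$ with integer slopes; $\operatorname{sl}_{p,\nu}(f)$ is its outgoing slope at $p$ along $\nu\in T_p\Gamma$, and $\operatorname{div}(f)=\sum_p\bigl(-\sum_{\nu\in T_p\Gamma}\operatorname{sl}_{p,\nu}(f)\bigr)(p)$. $D\sim E$ means $D-E=\operatorname{div}(f)$ for some rational function $f$. The (Baker–Norine) rank $\mathbf r(D)$ is the maximum among $-1$ and the integers $k\ge0$ such that for all $p_1,\dots,p_k\in\Gamma$ the divisor $D-(p_1)-\cdots-(p_k)$ is linearly equivalent to an effective divisor. The canonical divisor is $K=\sum_p(\operatorname{val}(p)-2)(p)$. Gap sequences: for $D$ of degree $d$ and rank $r\ge 0$ and $p\in\Gamma$, $\underline n_D(p)=(n_1<\cdots<n_{r+1})$ lists the positive integers $m$ with $\mathbf r(D-m(p))<\mathbf r(D-(m-1)(p))$; there are exactly $r+1$ of them, all $\le d+1$. The weight is $\operatorname{wt}_D(p)=\sum_{i=1}^{r+1}(n_i-i)$.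 The $D$-Weierstrass locus is $\operatorname{WL}(D)=\{p\in\Gamma: \mathbf r(D-(r+1)(p))\ge0\}=\{p: \underline n_D(p)\ne(1,2,\dots,r+1)\}$. *)

(* Defs.v *)
From HB Require Import structures.
From mathcomp Require Import all_boot all_order all_algebra finmap.
From mathcomp Require Import boolp classical_sets functions cardinality reals.
From mathcomp Require Import topology normedtype.
From mathcomp.multinomials Require Import freeg.

Set Implicit Arguments.
Unset Strict Implicit.
Unset Printing Implicit Defensive.

Import Order.TTheory GRing.Theory Num.Theory.
Import numFieldNormedType.Exports.

Local Open Scope classical_set_scope.
Local Open Scope ring_scope.

(* A tropical curve, given by a finite connected graph (loops and multiple    *)
(* edges allowed) with positive real edge lengths.  The edge e is a copy of   *)
(* the segment [0, len e] glued to src e at 0 and to tgt e at len e.  The     *)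
(* field vertex_incident says that val(p) >= 1 at the vertices; it only       *)
(* excludes the one-point space.                                              *)
Record tropicalCurve (R : realType) := TropicalCurve {
  vertex : finType;
  edge : finType;
  src : edge -> vertex;
  tgt : edge -> vertex;
  len : edge -> R;
  len_gt0 : forall e, 0 < len e;
  vertex_gt0 : (0 < #|vertex|)%N;
  vertex_incident : forall v, exists e, (src e == v) || (tgt e == v);
  adj := fun u v : vertex =>
    [exists e, ((src e == u) && (tgt e == v)) || ((src e == v) && (tgt e == u))];
  connected : forall u v, connect adj u v
}.

Section TropicalCurve.
Context {R : realType} (G : tropicalCurve R).
Local Notation V := (vertex G).
Local Notation E := (edge G).

(* H_1(G, R) is the kernel of the cellular boundary map R^E -> R^V. *)
Definition boundary : 'M[R]_(#|E|, #|V|) :=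
  \matrix_(i, j) ((tgt (enum_val i) == enum_val j)%:R -
                  (src (enum_val i) == enum_val j)%:R).

Definition genus : nat := \rank (kermx boundary).

Definition inner_pt (e : E) := {t : R | 0 < t < len e}.

Definition tpoint : Type := (V + {e : E & inner_pt e})%type.

HB.instance Definition _ := Choice.on tpoint.

(* The parametrization [0, len e] -> G of the edge e. *)
Definition pt (e : E) (t : R) : tpoint :=
  if insub t is Some u then inr (Tagged inner_pt (u : inner_pt e))
  else inl (if t <= 0 then src e else tgt e).

(* The path metric: infimum of the lengths of the finite concatenations of    *)
(* segments, each contained in a closed edge.                                 *)
Inductive path_length : tpoint -> tpoint -> R -> Prop :=
| PathNil p : path_length p p 0
| PathCons e s t q l : 0 <= s <= len e -> 0 <= t <= len e ->
    path_length (pt e t) q l -> path_length (pt e s) q (`|s - t| + l).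

Definition pdist (p q : tpoint) : R := inf [set l | path_length p q l].

Lemma pt_src e : pt e 0 = inl (src e).
Proof. by rewrite /pt insubF ?ltxx // lexx. Qed.

Lemma pt_tgt e : pt e (len e) = inl (tgt e).
Proof. by rewrite /pt insubF ?ltxx ?andbF // leNgt len_gt0. Qed.

Lemma pt_inner e (u : inner_pt e) : pt e (val u) = inr (Tagged inner_pt u).
Proof. by rewrite /pt valK. Qed.

Lemma pt_surj (p : tpoint) : exists e t, 0 <= t <= len e /\ p = pt e t.
Proof.
case: p => [v|[e u]].
  have [e /orP[/eqP <-|/eqP <-]] := vertex_incident v.
    by exists e, 0; rewrite pt_src lexx ltW ?len_gt0.
  by exists e, (len e); rewrite pt_tgt lexx ltW ?len_gt0.
exists e, (val u); rewrite pt_inner; split=> //.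
by have /andP[/ltW -> /ltW ->] := valP u.
Qed.

Lemma path_length_ge0 p q l : path_length p q l -> 0 <= l.
Proof. by elim=> // *; exact: addr_ge0. Qed.

Lemma path_length_cat p q r l m :
  path_length p q l -> path_length q r m -> path_length p r (l + m).
Proof.
elim=> [x|e s t x k hs ht _ IH] h; first by rewrite add0r.
by rewrite -addrA; apply: PathCons => //; exact: IH.
Qed.

Lemma path_length1 e s t : 0 <= s <= len e -> 0 <= t <= len e ->
  path_length (pt e s) (pt e t) `|s - t|.
Proof. by move=> hs ht; rewrite -(addr0 `|s - t|); apply: PathCons => //; constructor. Qed.

Lemma path_length_sym p q l : path_length p q l -> path_length q p l.
Proof.
elim=> [x|e s t x k hs ht _ IH]; first by constructor.
by rewrite addrC distrC; apply: path_length_cat IH _; exact: path_length1.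
Qed.

Lemma path_length_exists p q : exists l, path_length p q l.
Proof.
have cat a b c : (exists l, path_length a b l) ->
    (exists l, path_length b c l) -> exists l, path_length a c l.
  by move=> [l hl] [m hm]; exists (l + m); exact: path_length_cat hl hm.
have sym a b : (exists l, path_length a b l) -> exists l, path_length b a l.
  by move=> [l hl]; exists l; exact: path_length_sym.
have toV (x : tpoint) : exists v : V, exists l, path_length x (inl v) l.
  have [e [t [ht ->]]] := pt_surj x; exists (src e), `|t - 0|.
  by rewrite -pt_src; apply: path_length1; rewrite // lexx ltW ?len_gt0.
have [[v hv] [w hw]] := (toV p, toV q).
apply: (cat _ _ _ hv); apply: (cat _ _ _ _ (sym _ _ hw)).
have /connectP[s hs ->] := connected v w.
elim: s v {hv} hs => [|x s IH] v /=; first by exists 0; constructor.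
case/andP => /existsP[e he] hs; apply: (cat _ _ _ _ (IH _ hs)).
have hst : exists l, path_length (inl (src e)) (inl (tgt e)) l.
  exists `|0 - len e|; rewrite -pt_src -pt_tgt.
  by apply: path_length1; rewrite !lexx ltW ?len_gt0.
by case/orP: he => /andP[/eqP <- /eqP <-] //; exact: sym.
Qed.

Lemma has_inf_path_length p q : has_inf [set l | path_length p q l].
Proof.
split; first exact: path_length_exists.
by exists 0 => l; exact: path_length_ge0.
Qed.

Lemma pdist_le p q l : path_length p q l -> pdist p q <= l.
Proof. by move=> h; apply: ge_inf => //; case: (has_inf_path_length p q). Qed.

Lemma pdist_ge p q x :
  (forall l, path_length p q l -> x <= l) -> x <= pdist p q.
Proof.
move=> h; apply: lb_le_inf; first by case: (has_inf_path_length p q).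
by move=> l /h.
Qed.

Lemma pdist_ge0 p q : 0 <= pdist p q.
Proof. by apply: pdist_ge => l; exact: path_length_ge0. Qed.

Lemma pdistxx p : pdist p p = 0.
Proof. by apply/le_anti; rewrite pdist_ge0 andbT; apply: pdist_le; constructor. Qed.

Lemma pdist_sym p q : pdist p q = pdist q p.
Proof.
by apply/le_anti/andP; split; apply: pdist_ge => l h; apply: pdist_le;
   exact: path_length_sym.
Qed.

Lemma pdist_triangle q p r : pdist p r <= pdist p q + pdist q r.
Proof.
rewrite -lerBlDr; apply: pdist_ge => l hl.
rewrite lerBlDr addrC -lerBlDr; apply: pdist_ge => m hm.
by rewrite lerBlDr addrC; apply: pdist_le; exact: path_length_cat hl hm.
Qed.

Lemma lip_pdist (f : tpoint -> R) :
  (forall e s t, 0 <= s <= len e -> 0 <= t <= len e ->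
     `|f (pt e s) - f (pt e t)| <= `|s - t|) ->
  forall p q, `|f p - f q| <= pdist p q.
Proof.
move=> hf p q; apply: pdist_ge => l; elim=> [x|e s t x k hs ht _ IH].
  by rewrite subrr normr0.
by apply: le_trans (ler_distD (f (pt e t)) _ _) _; rewrite lerD ?hf.
Qed.

Lemma len_lb : exists2 c : R, 0 < c & forall e : E, c <= len e.
Proof.
exists (\big[Num.min/1]_(e : E) len e) => [|e]; last exact: bigmin_le_cond.
by elim/big_ind: _ => // [x y hx hy|e _]; rewrite ?lt_min ?hx ?hy ?len_gt0.
Qed.

Lemma pdist_positivity p q : pdist p q = 0 -> p = q.
Proof.
have inner e (u : inner_pt e) (x : tpoint) :
    pdist (inr (Tagged inner_pt u)) x = 0 -> inr (Tagged inner_pt u) = x.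
  have /andP[u0 ul] := valP u.
  pose d := Num.min (val u) (len e - val u).
  have d0 : 0 < d by rewrite lt_min u0 subr_gt0.
  pose f (y : tpoint) : R := if y is inr z then
    if tag z == e then Num.max 0 (d - `|val (tagged z) - val u|) else 0 else 0.
  have fin (t : R) : 0 <= t <= len e ->
      f (pt e t) = Num.max 0 (d - `|t - val u|).
    move=> /andP[t0 tl]; rewrite /pt; case: insubP => [w _ <-|].
      by rewrite /f /= eqxx.
    rewrite negb_and -!leNgt /f => /orP[h|h].
      have -> : t = 0 by apply/le_anti/andP.
      rewrite sub0r normrN gtr0_norm // max_l // subr_le0.
      by rewrite ge_min lexx.
    have -> : t = len e by apply/le_anti/andP.
    rewrite gtr0_norm ?subr_gt0 // max_l // subr_le0.
    by rewrite ge_min lexx orbT.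
  have fout e' (t : R) : e' != e -> f (pt e' t) = 0.
    by move=> ne; rewrite /pt; case: insubP => // w _ _; rewrite /f /= (negbTE ne).
  have maxlip (a b : R) : `|Num.max 0 a - Num.max 0 b| <= `|a - b|.
    wlog: a b / b <= a.
      by move=> W; case: (leP b a) => [|/ltW] /W //; rewrite distrC (distrC a).
    move=> ba; rewrite !ger0_norm ?subr_ge0 //; last first.
      by rewrite ge_max !le_max lexx ba orbT.
    rewrite lerBlDr ge_max; apply/andP; split.
      by rewrite addr_ge0 ?subr_ge0 // le_max lexx.
    by rewrite -lerBlDl subKr le_max lexx orbT.
  move=> /eqP h; have : `|f (inr (Tagged inner_pt u)) - f x| <= 0.
    rewrite -(eqP h); apply: lip_pdist => e' s t hs ht.
    have [ee|ne] := eqVneq e' e; last by rewrite !fout // subrr normr0.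
    move: hs ht; rewrite ee => hs ht; rewrite !fin //.
    apply: le_trans (maxlip _ _) _.
    rewrite opprD addrACA subrr add0r opprK addrC.
    apply: le_trans (ler_dist_dist _ _) _.
    by rewrite opprB addrA subrK distrC.
  rewrite normr_le0 subr_eq0 {1}/f /= eqxx subrr normr0 subr0 max_r ?ltW //.
  case: x {h} => [v|[e' w]] /eqP; rewrite /f /=.
    by move=> h; move: d0; rewrite h ltxx.
  case: eqP => [ee|_] h; last by move: d0; rewrite h ltxx.
  subst e'; congr (inr (Tagged _ _)); apply/esym/val_inj/eqP.
  rewrite -subr_eq0 -normr_le0 leNgt; apply/negP => n0.
  have : Num.max 0 (d - `|val w - val u|) < d by rewrite gt_max d0 ltrBlDr ltrDl.
  by rewrite -h ltxx.
case: p => [v|[e u]]; last exact: inner.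
case: q => [w|[e u]]; last by rewrite pdist_sym => /inner.
have [->//|vw] := eqVneq v w; move=> h0.
have [c c0 cle] := len_lb.
pose f (y : tpoint) : R := match y with
  | inl x => c * (x == v)%:R
  | inr z => c * ((src (tag z) == v)%:R +
      ((tgt (tag z) == v)%:R - (src (tag z) == v)%:R) *
        (val (tagged z) / len (tag z)))
  end.
have fE e (t : R) : 0 <= t <= len e -> f (pt e t) =
    c * ((src e == v)%:R + ((tgt e == v)%:R - (src e == v)%:R) * (t / len e)).
  move=> /andP[t0 tl]; rewrite /pt; case: insubP => [u _ <-//|].
  rewrite negb_and -!leNgt => /orP[h|h].
    by rewrite h (_ : t = 0) ?mul0r ?mulr0 ?addr0 //; apply/le_anti/andP.
  rewrite (_ : t = len e); last by apply/le_anti/andP.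
  by rewrite leNgt len_gt0 /= divff ?gt_eqF ?len_gt0 // mulr1 addrC subrK.
have : `|f (inl v) - f (inl w)| <= 0.
  rewrite -h0; apply: lip_pdist => e s t hs ht; rewrite !fE // -mulrBr.
  rewrite opprD addrACA subrr add0r -mulrBr -mulrBl !normrM.
  rewrite (gtr0_norm c0) normfV (gtr0_norm (len_gt0 e)).
  have h1 : `|(tgt e == v)%:R - (src e == v)%:R| <= 1 :> R.
    by do 2!case: (_ == v); rewrite ?subrr ?subr0 ?sub0r ?normrN ?normr0 ?normr1.
  have h2 : c * (`|s - t| / len e) <= `|s - t|.
    by rewrite mulrCA ler_piMr // ler_pdivrMr ?len_gt0 // mul1r.
  rewrite mulrCA; apply: le_trans (ler_wpM2r _ h1) _; last by rewrite mul1r.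
  apply: mulr_ge0; first exact: ltW.
  by apply: divr_ge0 => //; exact/ltW/len_gt0.
rewrite /f /= eqxx eq_sym (negbTE vw) mulr1 mulr0 subr0 normr_le0 => /eqP h.
by move: c0; rewrite h ltxx.
Qed.

HB.instance Definition _ := isMetric.Build R tpoint
  pdistxx pdist_positivity pdist_sym pdist_triangle.

(* A tangent direction is a half-edge: (e, false) is the direction of         *)
(* increasing parameter on e, (e, true) that of decreasing parameter.  A      *)
(* loop at a vertex thus contributes two directions.                          *)
Definition tangent (p : tpoint) : {set E * bool} :=
  match p with
  | inl v => [set h : E * bool | (if h.2 then tgt h.1 else src h.1) == v]%SET
  | inr x => [set h : E * bool | h.1 == tag x]%SET
  end.

Definition valence (p : tpoint) : nat := #|tangent p|.

Definition coord (p : tpoint) (h : E * bool) : R :=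
  match p with
  | inl _ => if h.2 then len h.1 else 0
  | inr x => val (tagged x)
  end.

(* The point at small distance t from p in the direction h \in tangent p. *)
Definition ray (p : tpoint) (h : E * bool) (t : R) : tpoint :=
  pt h.1 (if h.2 then coord p h - t else coord p h + t).

(* Continuity is built in: the pieces are closed and cover [0, len e]. *)
Definition rational_function (f : tpoint -> R) : Prop :=
  forall e : E, exists s : seq R,
    [/\ path <%R 0 s, last 0 s = len e &
      forall i, (i < size s)%N -> exists (m : int) (c : R),
        forall t, nth 0 (0 :: s) i <= t <= nth 0 s i ->
          f (pt e t) = m%:~R * t + c].

(* The default value 0 is never reached for f rational and h \in tangent p. *)
Definition slope (f : tpoint -> R) (p : tpoint) (h : E * bool) : int :=
  xget 0 [set m : int | \forall t \near 0^'+, f (ray p h t) = f p + m%:~R * t].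

Definition divisor := {freeg tpoint}.

Definition ord (f : tpoint -> R) (p : tpoint) : int :=
  - \sum_(h in tangent p) slope f p h.

Definition lin_equiv (D D' : divisor) : Prop :=
  exists2 f, rational_function f & forall p, coeff p (D - D') = ord f p.

Definition effective (D : divisor) : Prop := forall p, 0 <= coeff p D.

Definition rank_ge (D : divisor) (k : nat) : Prop :=
  forall s : k.-tuple tpoint,
    exists2 D', effective D' & lin_equiv (D - \sum_(p <- s) << p >>) D'.

Definition rank_set (D : divisor) : set int :=
  [set -1] `|` [set k%:Z | k in [set k : nat | rank_ge D k]].

(* The Baker-Norine rank: the maximum of rank_set D, which exists since that  *)
(* set is bounded above by max(-1, deg D).                                    *)
Definition rank (D : divisor) : int :=
  xget (-1) (rank_set D `&` ubound (rank_set D)).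

(* A sum over the vertices suffices, since the other points have valence 2:   *)
(* see coeff_canonical.                                                       *)
Definition canonical : divisor :=
  \sum_(v : V) << (valence (inl v))%:Z - 2 *g (inl v : tpoint) >>.

Lemma coeff_canonical p : coeff p canonical = (valence p)%:Z - 2.
Proof.
rewrite /canonical raddf_sum /=; under eq_bigr do rewrite coeffU.
case: p => [v|x].
  rewrite (bigD1 v) //= eqxx mulr1 big1 ?addr0 // => w wv.
  by rewrite (_ : _ == _ = (w == v)) // (negbTE wv) mulr0.
rewrite big1 => [|v _]; last by rewrite mulr0.
pose T : {set E * bool} := finset.setX [set tag x]%SET [set: bool]%SET.
rewrite /valence (_ : tangent (inr x) = T) ?cardsX ?cards1 ?cardsT ?card_bool //.
by apply/setP => -[e b]; rewrite !inE andbT.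
Qed.

Definition gap_set (D : divisor) (p : tpoint) : set nat :=
  [set m : nat | (0 < m)%N &&
    (rank (D - << m%:Z *g p >>) < rank (D - << m%:Z - 1 *g p >>))].

(* The increasing list of the gaps; all of them are at most deg D + 1, so     *)
(* fset_set applies to a finite set here.                                     *)
Definition gap_seq (D : divisor) (p : tpoint) : seq nat :=
  sort leq (fset_set (gap_set D p)).

(* There are rank D + 1 gaps; they are indexed from 0, whence the shift. *)
Definition weight (D : divisor) (p : tpoint) : int :=
  \sum_(i < size (gap_seq D p)) ((nth 0%N (gap_seq D p) i)%:Z - i.+1%:Z).

Definition WL (D : divisor) : set tpoint :=
  [set p | 0 <= rank (D - << rank D + 1 *g p >>)].

End TropicalCurve.

(* Main.v *)
(* If p, q, x lie in this order on one edge with x - q = r (q - p), then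
   r (p) + (x) ~ (r + 1)(q).  Hence if D has rank r and r(D - r (p)) >= 1, all the
   points q near p on an edge at p lie in WL(D).  So at an isolated point p the
   gaps are 1, ..., r and some N <= deg D + 1, and wt_D(p) = N - r - 1 is at most
   deg D - r; this gives (1) and (2) in view of r(K) >= g - 1 and
   r(D) >= deg D - g.

   The two rank inequalities are the half of Riemann-Roch coming from Dhar's
   burning algorithm.  For D effective, the pointwise infimum f of the functions
   with f(q) = 0, f <= 0 and D + div f >= 0 is again such a function, and if
   D - q is not equivalent to an effective divisor, burning D - q + div f from q
   burns everything, which bounds this divisor by the moderator
   sum_v (indeg(v) - 1)(v) of a total order on a finite set of points.  Moderators
   have degree g - 1, are not equivalent to effective divisors, and opposite orders
   have moderators summing to K.

   For (3), join p to a vertex w by n + 1 edges of length 1 and put k loops at w: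
   the genus is n + k and n (p) - (x) is not equivalent to an effective divisor for
   x on an open edge at p.  With D ~ N (p) of rank N - n the tent equivalence shows
   that p is isolated, of weight n.  The case k = 1, n = g - 1 has K ~ (2g - 2)(p),
   and k = 0, n = g with D = d (p) is used for (2). *)

From mathcomp Require Import all_boot all_order all_algebra finmap.
From mathcomp Require Import boolp classical_sets cardinality reals topology.
From mathcomp Require Import normedtype ring lra zify.
From mathcomp.multinomials Require Import freeg.
Require Import Defs.

Set Implicit Arguments.
Unset Strict Implicit.
Unset Printing Implicit Defensive.

Import Order.TTheory GRing.Theory Num.Theory.
Local Open Scope classical_set_scope.
Local Open Scope ring_scope.

(** * Integral piecewise affine functions of one variable *)

Section PiecewiseAffine.
Context {R : realType}.
Implicit Types (phi : R -> R) (a b l x y z t : R) (s : seq R) (ab : R * R).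

(** The obstacle is the metric setting: existence statements need a substitute for compactness, and
    integrality provides it. If [D] is effective and D + div f >= 0, the slopes of f are bounded by
    deg D and f is concave away from the chips of [D]. So only finitely many slopes can support the
    infimum of such functions, which is therefore piecewise affine with integer slopes again. For
    this least f, D + div f plays the role of the q-reduced divisor, and its reducedness is used in
    the form of minimality: firing an unburnt set would produce a smaller function.

    Each argument runs on a finite model, a subdivision of the edges adapted to the functions and
    divisors at hand. Edges are cut at their midpoints before burning, because an order on the
    points cannot orient a segment whose two ends coincide.

    Twice an equality of divisors (with a moderator, and for the tents) is deduced from a one-sided
    inequality of coefficients and equal degrees, which spares the exact computation of slopes. *)

Definition int_affine phi a b :=
  exists (m : int) (c : R), forall t, a <= t <= b -> phi t = m%:~R * t + c.

Fixpoint segs a s l : seq (R * R) :=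
  if s is z :: s' then (a, z) :: segs z s' l else [:: (a, l)].

Definition cut_list a s l := path <%R a (rcons s l).

Lemma cut_list_lt a s l : cut_list a s l -> a < l.
Proof.
rewrite /cut_list; elim: s a => [|z s IH] a /=; first by rewrite andbT.
by case/andP=> az /IH; apply: lt_trans.
Qed.

Lemma mem_cut_list a s l z : cut_list a s l -> z \in s -> a < z < l.
Proof.
rewrite /cut_list; elim: s a => [|y s IH] a //= /andP[ay h].
rewrite inE => /orP[/eqP->|zs]; first by rewrite ay (cut_list_lt h).
by case/andP: (IH _ h zs) => yz ->; rewrite (lt_trans ay).
Qed.

Lemma segsP a s l ab : cut_list a s l -> ab \in segs a s l ->
  [/\ a <= ab.1, ab.1 < ab.2, ab.2 <= l,
     ab.1 \in a :: s /\ ab.2 \in rcons s l &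
     forall z, z \in s -> ~~ (ab.1 < z < ab.2)].
Proof.
rewrite /cut_list; elim: s a => [|y s IH] a /=.
  by rewrite andbT inE => al /eqP->; split; rewrite //= !inE !eqxx.
move=> /andP[ay h]; have yl := cut_list_lt h.
rewrite inE => /orP[/eqP->|/(IH _ h)[ya ab12 abl [m1 m2] hz]] /=.
  split=> //; first exact: ltW.
    by rewrite !inE !eqxx.
  move=> z; rewrite inE => /orP[/eqP->|/(mem_cut_list h)/andP[yz _]].
    by rewrite ltxx andbF.
  by rewrite negb_and -!leNgt orbC ltW.
split=> //; first by rewrite (le_trans _ ya) ?ltW.
  by rewrite inE m1 orbT inE m2 orbT.
move=> z; rewrite inE => /orP[/eqP->|]; last exact: hz.
by rewrite negb_and -!leNgt ya.
Qed.

Lemma segs_cover a s l t : cut_list a s l -> a <= t <= l ->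
  exists2 ab, ab \in segs a s l & ab.1 <= t <= ab.2.
Proof.
rewrite /cut_list; elim: s a => [|y s IH] a /=.
  by move=> _ h; exists (a, l); rewrite ?inE.
move=> /andP[ay h] /andP[at_ tl]; have [ty|yt] := leP t y.
  by exists (a, y); rewrite /= ?inE ?eqxx ?at_.
have [|ab hab ht] := IH _ h; first by rewrite (ltW yt) tl.
by exists ab; rewrite // inE hab orbT.
Qed.

(** A search by right ends stops, at a cut, on the segment to its left, hence the interval open on
    the left. [fire] locates its segment in this way. *)
Lemma segs_find a s l ab t : cut_list a s l -> ab \in segs a s l ->
  ab.1 < t <= ab.2 ->
  nth (0, 0) (segs a s l) (find (fun cd => t <= cd.2) (segs a s l)) = ab.
Proof.
rewrite /cut_list; elim: s a => [|y s IH] a /=.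
  by move=> _; rewrite inE => /eqP-> /= /andP[_ ->].
move=> /andP[ay h]; rewrite inE => /orP[/eqP->/= /andP[_ ->]//|hab ht].
have [ya _ _ _ _] := segsP h hab.
rewrite leNgt (le_lt_trans ya) /=; last by case/andP: ht.
exact: IH.
Qed.

Lemma map_segs_left a s l : [seq ab.1 | ab <- segs a s l] = a :: s.
Proof. by elim: s a => //= y s IH a; rewrite IH. Qed.

Lemma map_segs_right a s l : [seq ab.2 | ab <- segs a s l] = rcons s l.
Proof. by elim: s a => //= y s IH a; rewrite IH. Qed.

Lemma big_segs_left (M : nmodType) (F : R -> M) a s l :
  \sum_(ab <- segs a s l) F ab.1 = \sum_(x <- a :: s) F x.
Proof. by rewrite -(map_segs_left a s l) big_map. Qed.

Lemma big_segs_right (M : nmodType) (F : R -> M) a s l :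
  \sum_(ab <- segs a s l) F ab.2 = \sum_(x <- rcons s l) F x.
Proof. by rewrite -(map_segs_right a s l) big_map. Qed.

Lemma nth_segs a s l j : (j <= size s)%N ->
  nth (0, 0) (segs a s l) j = (nth 0 (a :: s) j, nth 0 (rcons s l) j).
Proof. by elim: s a j => [|y s IH] a [|j] //= jlt; rewrite IH. Qed.

Lemma size_segs a s l : size (segs a s l) = (size s).+1.
Proof. by elim: s a => //= y s IH a; rewrite IH. Qed.

(** The cuts form an unordered list in which repetitions and values outside [a, b] are allowed: sums
    concatenate the lists and restrictions keep them. [rational_functionP] translates the ordered
    subdivisions of [rational_function] into this form. *)
Definition int_pl phi a b := exists s : seq R, forall x y,
  a <= x -> x < y -> y <= b -> (forall z, z \in s -> ~~ (x < z < y)) ->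
  int_affine phi x y.

Lemma int_affine_sub phi a b x y : int_affine phi a b -> a <= x -> y <= b ->
  int_affine phi x y.
Proof.
move=> [m [c h]] ax yb; exists m, c => t /andP[xt ty]; apply: h.
by rewrite (le_trans ax) ?(le_trans ty).
Qed.

Definition sort_cuts a s l := sort <=%R (undup [seq x <- s | a < x < l]).

Lemma mem_sort_cuts a s l z :
  (z \in sort_cuts a s l) = (a < z < l) && (z \in s).
Proof. by rewrite mem_sort mem_undup mem_filter. Qed.

Lemma sort_cutsP a s l : a < l -> cut_list a (sort_cuts a s l) l.
Proof.
move=> al; rewrite /cut_list rcons_path; apply/andP; split.
  rewrite lt_path_sortedE; apply/andP; split.
    by apply/allP => x; rewrite mem_sort_cuts => /andP[/andP[]].
  by rewrite lt_sorted_uniq_le sort_uniq undup_uniq sort_le_sorted.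
have := mem_last a (sort_cuts a s l).
by rewrite inE mem_sort_cuts => /orP[/eqP->//|/andP[/andP[]]].
Qed.

Lemma int_pl_segs phi a b s : cut_list a s b ->
  (forall ab, ab \in segs a s b -> int_affine phi ab.1 ab.2) -> int_pl phi a b.
Proof.
move=> hs h; exists s => x y ax xy yb hz; move: hs h ax hz; rewrite /cut_list.
elim: s a => [|z s IH] a /=.
  move=> _ h ax _; apply: int_affine_sub (h (a, b) _) ax yb; by rewrite inE.
move=> /andP[az hs] h ax hz; have [zx|xz] := leP z x.
  apply: IH hs _ zx _ => [ab hab|w hw]; first by apply: h; rewrite inE hab orbT.
  by apply: hz; rewrite inE hw orbT.
apply: int_affine_sub (h (a, z) _) ax _; first by rewrite inE eqxx.
by have := hz z; rewrite inE eqxx xz /= -leNgt; apply.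
Qed.

Lemma int_plW phi a b x y : int_pl phi a b -> a <= x -> y <= b -> int_pl phi x y.
Proof.
move=> [s h] ax yb; exists s => u v xu uv vy; apply: h => //.
  exact: le_trans xu.
exact: le_trans vy _.
Qed.

Lemma int_pl_sub phi psi a b : (forall t, a <= t <= b -> phi t = psi t) ->
  int_pl phi a b -> int_pl psi a b.
Proof.
move=> e [s h]; exists s => x y ax xy yb hz; have [m [c hm]] := h _ _ ax xy yb hz.
exists m, c => t /andP[xt ty]; rewrite -e ?hm ?xt //.
by rewrite (le_trans ax xt) (le_trans ty yb).
Qed.

Lemma int_pl_glue phi a b s : cut_list a s b ->
  (forall ab, ab \in segs a s b -> int_pl phi ab.1 ab.2) -> int_pl phi a b.
Proof.
rewrite /cut_list; elim: s a => [|z s IH] a /=.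
  by move=> _ h; apply: (h (a, b)); rewrite inE.
move=> /andP[az hs] h; have [|s2 h2] := IH _ hs.
  by move=> ab hab; apply: h; rewrite inE hab orbT.
have [|s1 h1] := h (a, z); first by rewrite inE eqxx.
exists (z :: s1 ++ s2) => x y ax xy yb hz; have [zx|xz] := leP z x.
  by apply: h2 => // w hw; apply: hz; rewrite inE mem_cat hw !orbT.
apply: h1 => //= => [|w hw]; last by apply: hz; rewrite inE mem_cat hw !orbT.
by have := hz z; rewrite inE eqxx xz /= -leNgt; apply.
Qed.

Lemma int_plD phi psi a b : int_pl phi a b -> int_pl psi a b ->
  int_pl (fun t => phi t + psi t) a b.
Proof.
move=> [s h] [s' h']; exists (s ++ s') => x y ax xy yb hz.
have [|m [c hm]] := h x y ax xy yb.
  by move=> z zs; apply: hz; rewrite mem_cat zs.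
have [|m' [c' hm']] := h' x y ax xy yb.
  by move=> z zs; apply: hz; rewrite mem_cat zs orbT.
exists (m + m'), (c + c') => t ht; rewrite hm // hm' // rmorphD /=; ring.
Qed.

Lemma int_plN phi a b : int_pl phi a b -> int_pl (fun t => - phi t) a b.
Proof.
move=> [s h]; exists s => x y ax xy yb /(h x y ax xy yb)[m [c hm]].
by exists (- m), (- c) => t ht; rewrite hm // rmorphN /=; ring.
Qed.

Lemma int_affine_pl phi a b : int_affine phi a b -> int_pl phi a b.
Proof. by move=> h; exists [::] => x y ax _ yb _; apply: int_affine_sub h ax yb. Qed.

(* Two lines of different slopes meet in one point, and between two consecutive
   such points the minimum is attained by a single line. *)
Lemma int_pl_min phi a b (L : seq (int * R)) :
  (forall t, a <= t <= b -> exists2 mc, mc \in L & phi t = mc.1%:~R * t + mc.2) ->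
  (forall t mc, a <= t <= b -> mc \in L -> phi t <= mc.1%:~R * t + mc.2) ->
  int_pl phi a b.
Proof.
move=> hex hle.
(* The abscissas of the crossings; for equal slopes the quotient is 0 by convention, a harmless
   extra cut. The line attained at the midpoint [u] is minimal on all of [x, y], since a line
   passing below it somewhere would cross it strictly inside. *)
exists [seq (mc.2 - nd.2) / (nd.1 - mc.1)%:~R | mc <- L, nd <- L].
move=> x y ax xy yb hz; pose u := (x + y) / 2.
have hab t : x <= t <= y -> a <= t <= b.
  by case/andP=> xt ty; rewrite (le_trans ax xt) (le_trans ty yb).
have xu : x < u by rewrite /u; lra.
have uy : u < y by rewrite /u; lra.
have hu : x <= u <= y by rewrite !ltW.
have [[m c] mcL /= emc] := hex u (hab _ hu).
exists m, c => t ht; have [[n d] ndL /= end_] := hex t (hab _ ht).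
apply/le_anti; rewrite (hle _ (m, c) (hab _ ht)) //=.
rewrite leNgt; apply/negP => lt_t; rewrite end_ in lt_t.
have le_u : m%:~R * u + c <= n%:~R * u + d by rewrite -emc (hle _ (n, d) (hab _ hu)).
have nm : (n - m)%:~R != 0 :> R.
  rewrite intr_eq0; apply/eqP => /eqP; rewrite subr_eq0 => /eqP e.
  by move: lt_t le_u; rewrite e; lra.
set w := (c - d) / (n - m)%:~R; have ew : (n - m)%:~R * (w : R) = c - d.
  by rewrite /w mulrC divfK.
have /hz /negP[] : (w : R) \in [seq (mc.2 - nd.2) / (nd.1 - mc.1)%:~R | mc <- L, nd <- L].
  by apply/allpairsP; exists ((m, c), (n, d)).
have e z : n%:~R * z + d - (m%:~R * z + c) = (n - m)%:~R * (z - w).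
  by rewrite mulrBr ew rmorphB /=; ring.
have := e t; have := e u; move: (lt_t) (le_u); rewrite -subr_lt0 -subr_ge0.
move=> h1 h2 e1 e2; rewrite e2 in h1; rewrite e1 in h2.
case/andP: ht => xt ty; have [p0|n0|z0] := ltgtP ((n - m)%:~R : R) 0.
- have : w < t by rewrite -subr_gt0; rewrite nmulr_rlt0 in h1.
  have : u <= w by rewrite -subr_le0; rewrite nmulr_rge0 in h2.
  by move=> uw wt; rewrite (lt_le_trans xu uw) (lt_le_trans wt ty).
- have : t < w by rewrite -subr_lt0; rewrite pmulr_rlt0 in h1.
  have : w <= u by rewrite -subr_ge0; rewrite pmulr_rge0 in h2.
  by move=> wu tw; rewrite (le_lt_trans xt tw) (le_lt_trans wu uy).
- by move/eqP: z0; rewrite (negbTE nm).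
Qed.

End PiecewiseAffine.

Section RationalFunctions.
Context {R : realType} {G : tropicalCurve R}.
Implicit Types (f g : tpoint G -> R) (p q : tpoint G) (e : edge G) (a b t : R).

Lemma rational_functionP f :
  rational_function f <-> forall e, int_pl (fun t => f (pt e t)) 0 (len e).
Proof.
split=> h e.
  have [s [hs hl hseg]] := h e.
  case/lastP: s hs hl hseg => [_ /= l0|s z hs].
    by have := len_gt0 e; rewrite -l0 ltxx.
  rewrite last_rcons => zl; subst z => hseg.
  apply: (int_pl_segs hs) => -[a b] /(nthP (0, 0))[i].
  rewrite size_segs => ilt /= eab; have := hseg i; rewrite size_rcons => /(_ ilt).
  move: eab; rewrite nth_segs // => -[<- <-].
  by rewrite -rcons_cons nth_rcons ltnS /= -ltnS ilt.
have [s0 h0] := h e; have hs := sort_cutsP s0 (len_gt0 e).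
exists (rcons (sort_cuts 0 s0 (len e)) (len e)); split=> //.
  by rewrite last_rcons.
move=> i; rewrite size_rcons => ilt; set s := sort_cuts _ _ _ in hs ilt *.
rewrite -rcons_cons nth_rcons /= ilt.
have := @nth_segs R 0 s (len e) i ilt; set ab := nth (0, 0) _ _ => eab.
have hab : ab \in segs 0 s (len e) by apply: mem_nth; rewrite size_segs.
have [a0 ab12 bl _ hz] := segsP hs hab.
have {hz} hz z : z \in s0 -> ~~ (ab.1 < z < ab.2).
  move=> zs; apply/negP => /andP[h1 h2].
  have : z \in s.
    by rewrite mem_sort_cuts zs (le_lt_trans a0 h1) (lt_le_trans h2 bl).
  by move/hz; rewrite h1 h2.
by have := h0 _ _ a0 ab12 bl hz; rewrite eab.
Qed.
End RationalFunctions.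

(** * Slopes and concavity *)

Section Slopes.
Context {R : realType} {G : tropicalCurve R}.
Implicit Types (f g : tpoint G -> R) (p q : tpoint G) (e : edge G) (a b t : R).

(** There is room on the edge to leave the parameter [a] along [h]. Describing a direction by a
    half-edge and a parameter treats vertices and inner points alike, and tells the two ends of a
    loop apart. *)
Definition starts (h : edge G * bool) a : bool :=
  if h.2 then 0 < a <= len h.1 else 0 <= a < len h.1.

Lemma pt_innerE e a : 0 < a < len e ->
  exists2 u : inner_pt e, pt e a = inr (Tagged (@inner_pt R G) u) & val u = a.
Proof.
move=> h; exists (Sub a h : inner_pt e); last by rewrite SubK.
by rewrite -pt_inner SubK.
Qed.

Lemma starts_pt h a : starts h a ->
  h \in tangent (pt h.1 a) /\ coord (pt h.1 a) h = a.
Proof.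
case: h => e b; rewrite /starts /= => hb.
have [ha|ha] := boolP (0 < a < len e).
  by have [u -> <-] := pt_innerE ha; rewrite /= inE eqxx.
case: b hb ha => /= /andP[h1 h2]; rewrite ?h1 ?h2 ?andbT /= -leNgt => h3.
  have -> : a = len e by apply/le_anti; rewrite h2.
  by rewrite pt_tgt inE /= eqxx.
have -> : a = 0 by apply/le_anti; rewrite h1 h3.
by rewrite pt_src inE /= eqxx.
Qed.

Lemma tangentP p h : h \in tangent p ->
  starts h (coord p h) /\ p = pt h.1 (coord p h).
Proof.
case: h => e b; case: p => [v|[e' u]]; rewrite inE /=; last first.
  move=> /eqP ->; rewrite pt_inner; split=> //.
  by have /andP[h1 h2] := valP u; rewrite /starts /=; case: b; rewrite ?h1 ?h2 ltW.
by case: b => /= /eqP <-; rewrite /starts /= ?pt_tgt ?pt_src ?lexx ?len_gt0.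
Qed.

Lemma slope_unique f p h (m : int) (d : R) : 0 < d ->
  (forall t, 0 < t < d -> f (ray p h t) = f p + m%:~R * t) -> slope f p h = m.
Proof.
move=> d0 hd; have near_m : \forall t \near 0^'+, f (ray p h t) = f p + m%:~R * t.
  near=> t; apply: hd; apply/andP; split; near: t.
    exact: nbhs_right_gt.
  exact: nbhs_right_lt.
apply: xget_unique => // n near_n.
have : \forall t \near 0^'+, 0 < t /\ (n%:~R * t = m%:~R * t :> R).
  near=> t; split; first by near: t; exact: nbhs_right_gt.
  apply: (addrI (f p)).
  have <- : f (ray p h t) = f p + n%:~R * t by near: t; exact: near_n.
  by near: t; exact: near_m.
case/filter_ex=> t [t0 /(mulIf (lt0r_neq0 t0)) /eqP].
by rewrite eqr_int => /eqP.
Unshelve. all: by end_near.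
Qed.

Lemma ray_pt h a t : starts h a ->
  ray (pt h.1 a) h t = pt h.1 (if h.2 then a - t else a + t).
Proof. by move=> /starts_pt[_ ha]; rewrite /ray ha. Qed.

Lemma slope_affineR f e a b (m : int) c : 0 <= a -> a < b -> b <= len e ->
  (forall t, a <= t <= b -> f (pt e t) = m%:~R * t + c) ->
  slope f (pt e a) (e, false) = m.
Proof.
move=> a0 ab bl hf; apply: (@slope_unique _ _ _ _ (b - a)).
  by rewrite subr_gt0.
move=> t /andP[t0 tb]; rewrite (@ray_pt (e, false)); last by rewrite /starts /= a0 (lt_le_trans ab).
have h1 : a <= a + t <= b by apply/andP; split; lra.
have h2 : a <= a <= b by rewrite lexx ltW.
by rewrite /= !hf //; ring.
Qed.

Lemma slope_affineL f e a b (m : int) c : 0 <= a -> a < b -> b <= len e ->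
  (forall t, a <= t <= b -> f (pt e t) = m%:~R * t + c) ->
  slope f (pt e b) (e, true) = - m.
Proof.
move=> a0 ab bl hf; apply: (@slope_unique _ _ _ _ (b - a)).
  by rewrite subr_gt0.
move=> t /andP[t0 tb]; rewrite (@ray_pt (e, true)); last by rewrite /starts /= bl (le_lt_trans a0).
have h1 : a <= b - t <= b by apply/andP; split; lra.
have h2 : a <= b <= b by rewrite lexx ltW.
by rewrite /= !hf // rmorphN /=; ring.
Qed.

Lemma int_pl_right (phi : R -> R) a b : a < b -> int_pl phi a b ->
  exists2 x, a < x <= b & int_affine phi a x.
Proof.
move=> ab [s hs]; have hc := sort_cutsP s ab.
set d := sort_cuts _ _ _ in hc.
have : exists2 x, a < x <= b & forall z, z \in s -> ~~ (a < z < x).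
  have aff z : a < z < b -> z \in s -> z \in d by move=> h h'; rewrite mem_sort_cuts h.
  case: d hc aff => [|y d'] hc aff.
    exists b => [|z zs]; first by rewrite ab lexx.
    by apply/negP => h; have := aff z h zs.
  have /andP[ay yb] : a < y < b by apply: mem_cut_list hc _; rewrite inE eqxx.
  exists y => [|z zs]; first by rewrite ay ltW.
  apply/negP => /andP[az zy]; have := aff z _ zs.
  rewrite az (lt_trans zy yb) inE (lt_eqF zy) /= => /(_ isT).
  case/andP: hc => _ /mem_cut_list h /h; by rewrite (lt_gtF zy).
case=> x /andP[ax xb] hz; exists x; first by rewrite ax.
exact: hs.
Qed.

Lemma int_pl_left (phi : R -> R) a b : a < b -> int_pl phi a b ->
  exists2 x, a <= x < b & int_affine phi x b.
Proof.
move=> ab [s hs]; have [||x /andP[ax xb] [m [c h]]] :=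
    @int_pl_right (fun t => phi (- t)) (- b) (- a).
- by rewrite ltrN2.
- exists [seq - z | z <- s] => x y bx xy ya hz.
  have [||||m [c h]] := hs (- y) (- x).
  + by rewrite lerNr.
  + by rewrite ltrN2.
  + by rewrite lerNl.
  + move=> z zs; have /hz : - z \in [seq - z | z <- s] by apply: map_f.
    by rewrite andbC ltrNl ltrNr.
  exists (- m), c => t ht; rewrite h ?rmorphN /=; last by rewrite !lerN2 andbC.
  by ring.
exists (- x); first by rewrite lerNr xb ltrNl ax.
exists (- m), c => t /andP[h1 h2]; rewrite -(opprK t) h ?rmorphN /=; first by ring.
by rewrite lerN2 h2 lerNl.
Qed.

Lemma slopeP f p h : rational_function f -> h \in tangent p ->
  exists2 d, 0 < d & forall t, 0 <= t < d ->
    starts h (coord p h) /\ f (ray p h t) = f p + (slope f p h)%:~R * t.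
Proof.
move=> /rational_functionP hf /tangentP[]; set a := coord p h => ha ->.
have hpl := hf h.1; case: h a ha hpl => e [] a /=; rewrite /starts /=.
  move=> /andP[a0 al] /int_plW/(_ (lexx 0) al) /(int_pl_left a0)[x].
  move=> /andP[x0 xa] [m [c hm]]; exists (a - x); first by rewrite subr_gt0.
  move=> t /andP[t0 tx]; split; first by rewrite a0.
  rewrite (slope_affineL x0 xa al hm) (@ray_pt (e, true)) /starts /= ?a0 //.
  have h1 : x <= a - t <= a by apply/andP; split; lra.
  have h2 : x <= a <= a by rewrite lexx ltW.
  by rewrite !hm // rmorphN /=; ring.
move=> /andP[a0 al] /int_plW/(_ a0 (lexx _)) /(int_pl_right al)[x].
move=> /andP[ax xl] [m [c hm]]; exists (x - a); first by rewrite subr_gt0.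
move=> t /andP[t0 tx]; split; first by rewrite a0.
rewrite (slope_affineR a0 ax xl hm) (@ray_pt (e, false)) /starts /= ?a0 //.
have h1 : a <= a + t <= x by apply/andP; split; lra.
have h2 : a <= a <= x by rewrite lexx ltW.
by rewrite !hm //; ring.
Qed.

Lemma rational_functionD f g : rational_function f -> rational_function g ->
  rational_function (fun x => f x + g x).
Proof.
move=> /rational_functionP hf /rational_functionP hg.
by apply/rational_functionP => e; apply: int_plD.
Qed.

Lemma rational_functionN f : rational_function f ->
  rational_function (fun x => - f x).
Proof.
move=> /rational_functionP hf; apply/rational_functionP => e.
exact: (int_plN (hf e)).
Qed.

Lemma slopeD f g p h : rational_function f -> rational_function g ->
  h \in tangent p -> slope (fun x => f x + g x) p h = slope f p h + slope g p h.
Proof.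
move=> rf rg hp; have [d d0 hd] := slopeP rf hp; have [d' d0' hd'] := slopeP rg hp.
apply: (@slope_unique _ _ _ _ (Num.min d d')); first by rewrite lt_min d0.
move=> t; rewrite lt_min => /and3P[t0 td td'].
have [|_ ->] := hd t; first by rewrite ltW.
have [|_ ->] := hd' t; first by rewrite ltW.
by rewrite rmorphD /=; ring.
Qed.

Lemma slopeN f p h : rational_function f -> h \in tangent p ->
  slope (fun x => - f x) p h = - slope f p h.
Proof.
move=> rf hp; have [d d0 hd] := slopeP rf hp.
apply: (slope_unique d0) => t /andP[t0 td].
have [|_ ->] := hd t; first by rewrite ltW.
by rewrite rmorphN /=; ring.
Qed.

Lemma ordD f g p : rational_function f -> rational_function g ->
  ord (fun x => f x + g x) p = ord f p + ord g p.
Proof.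
move=> rf rg; rewrite /ord -opprD -big_split; congr (- _).
by apply: eq_bigr => h hp; rewrite slopeD.
Qed.

Lemma ordN f p : rational_function f -> ord (fun x => - f x) p = - ord f p.
Proof.
move=> rf; rewrite /ord; congr (- _); rewrite -sumrN.
by apply: eq_bigr => h hp; rewrite slopeN.
Qed.

Lemma rational_function_cst (c : R) : rational_function (fun _ : tpoint G => c).
Proof.
apply/rational_functionP => e; apply: int_affine_pl.
by exists 0, c => t _; rewrite mul0r add0r.
Qed.

Lemma ord_cst (c : R) p : ord (fun _ : tpoint G => c) p = 0.
Proof.
rewrite /ord big1 ?oppr0 // => h _; apply: (slope_unique ltr01) => t _.
by rewrite mul0r addr0.
Qed.

Lemma tangent_inner e a : 0 < a < len e ->
  tangent (pt e a) = [set (e, false); (e, true)]%SET.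
Proof.
move=> /pt_innerE[u -> _].
by apply/setP => -[e' []]; rewrite !inE /= !xpair_eqE /= ?andbF ?andbT ?orbF ?orbT.
Qed.

Lemma sum_tangent_inner (M : nmodType) (F : edge G * bool -> M) e a :
  0 < a < len e -> \sum_(h in tangent (pt e a)) F h = F (e, false) + F (e, true).
Proof.
move=> ha; rewrite tangent_inner // big_setU1 ?finset.big_set1 //.
by rewrite !inE xpair_eqE andbF.
Qed.

Lemma valence_inner e a : 0 < a < len e -> valence (pt e a) = 2.
Proof. by move=> ha; rewrite /valence -sum1_card sum_tangent_inner. Qed.

Lemma ord_inner f e a : 0 < a < len e ->
  ord f (pt e a) = - (slope f (pt e a) (e, false) + slope f (pt e a) (e, true)).
Proof. by move=> ha; rewrite /ord sum_tangent_inner. Qed.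

(* The third clause propagates the second one along the induction. *)
Lemma ord_ge0_concave_aux f e a b : rational_function f -> 0 <= a -> a < b ->
  b <= len e -> (forall u, a < u < b -> 0 <= ord f (pt e u)) ->
  let m := slope f (pt e a) (e, false) in
  let n := slope f (pt e b) (e, true) in
  [/\ forall t, a <= t <= b -> f (pt e t) <= f (pt e a) + m%:~R * (t - a),
      forall t, a <= t <= b -> f (pt e t) <= f (pt e b) + n%:~R * (b - t)
    & 0 <= m + n].
Proof.
move=> /rational_functionP rf a0 ab bl hord.
have [s hs] := int_plW (rf e) a0 bl.
have hc := sort_cutsP s ab; set d := sort_cuts _ _ _ in hc.
have {hs} : forall xy, xy \in segs a d b ->
    int_affine (fun t => f (pt e t)) xy.1 xy.2.
  move=> [x y] hxy; have [ax xy' yb _ hz] := segsP hc hxy; apply: hs => // z zs.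
  apply/negP => /andP[h1 h2]; have /hz : z \in d.
    by rewrite mem_sort_cuts zs (le_lt_trans ax h1) (lt_le_trans h2 yb).
  by rewrite h1 h2.
clearbody d; elim: d a a0 ab hord hc => [|z d IH] a a0 ab hord hc haff m n.
  have [|m' [c hm]] := haff (a, b); first by rewrite inE.
  have -> : m = m' by apply: slope_affineR hm.
  have -> : n = - m' by apply: slope_affineL hm.
  split; last by rewrite subrr.
    by move=> t ht; rewrite !hm //= ?lexx ?(ltW ab) //; lra.
  by move=> t ht; rewrite !hm //= ?lexx ?(ltW ab) // rmorphN /=; lra.
case/andP: (hc) => az hc'; have zb := cut_list_lt hc'.
have z0 := le_trans a0 (ltW az); have zl := le_trans (ltW zb) bl.
have H1 u : z < u < b -> 0 <= ord f (pt e u).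
  by move=> /andP[zu ub]; apply: hord; rewrite ub (lt_trans az).
have H2 xy : xy \in segs z d b -> int_affine (fun t => f (pt e t)) xy.1 xy.2.
  by move=> hxy; apply: haff; rewrite inE hxy orbT.
have := IH z z0 zb H1 hc' H2.
set mz := slope f (pt e z) (e, false); rewrite -/n => -[h1 h2 h3].
have [|m' [c hm]] := haff (a, z); first by rewrite inE eqxx.
have em : m = m' by apply: slope_affineR hm.
have := hord z; rewrite az zb => /(_ isT).
rewrite ord_inner ?(le_lt_trans a0 az) ?(lt_le_trans zb bl) // -/mz.
rewrite (slope_affineL a0 az zl hm) -em => ozp.
(* Since [ord] is minus the sum of the outgoing slopes, [0 <= ord] at the cut [z] says that the
   slope does not increase there. *)
have hmm : mz <= m by move: ozp; rewrite oppr_ge0 subr_le0.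
have hmn : 0 <= m + n by rewrite (le_trans h3) // lerD2r.
have hm1 : (mz%:~R : R) <= m%:~R by rewrite ler_int.
have hm2 : 0 <= (m%:~R + n%:~R : R) by rewrite -intrD ler0z.
have hfz : f (pt e z) = f (pt e a) + m%:~R * (z - a).
  by rewrite !hm /= ?lexx ?(ltW az) // em; ring.
split=> // t /andP[at_ tb]; have [tz|zt] := leP t z.
- by rewrite !hm /= ?lexx ?at_ ?(ltW az) // em; lra.
- apply: le_trans (h1 t _) _; first by rewrite (ltW zt).
  rewrite hfz -addrA lerD2l.
  have : mz%:~R * (t - z) <= m%:~R * (t - z) by rewrite ler_wpM2r // subr_ge0 ltW.
  by lra.
- have := h2 z; rewrite lexx (ltW zb) => /(_ isT).
  have -> : f (pt e t) = f (pt e z) + m%:~R * (t - z).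
    by rewrite !hm /= ?lexx ?at_ ?(ltW az) // em; ring.
  have : 0 <= (m%:~R + n%:~R : R) * (z - t) by rewrite mulr_ge0 // subr_ge0.
  by lra.
- by apply: h2; rewrite (ltW zt).
Qed.

Lemma ord_ge0_concaveR f e a b t : rational_function f -> 0 <= a -> a < b ->
  b <= len e -> (forall u, a < u < b -> 0 <= ord f (pt e u)) -> a <= t <= b ->
  f (pt e t) <= f (pt e a) + (slope f (pt e a) (e, false))%:~R * (t - a).
Proof. by move=> rf a0 ab bl /(ord_ge0_concave_aux rf a0 ab bl)[h _ _]; exact: h. Qed.

Lemma ord_ge0_concaveL f e a b t : rational_function f -> 0 <= a -> a < b ->
  b <= len e -> (forall u, a < u < b -> 0 <= ord f (pt e u)) -> a <= t <= b ->
  f (pt e t) <= f (pt e b) + (slope f (pt e b) (e, true))%:~R * (b - t).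
Proof. by move=> rf a0 ab bl /(ord_ge0_concave_aux rf a0 ab bl)[_ h _]; exact: h. Qed.

(** Concavity, with the extra information that the supporting slope is up to sign an outgoing slope
    of [f]: [slope_bound] then confines it to finitely many integers. *)
Lemma ord_ge0_supergradient f e a b t : rational_function f -> 0 <= a -> a < b ->
  b <= len e -> (forall u, a < u < b -> 0 <= ord f (pt e u)) -> a <= t <= b ->
  exists2 m : int, exists h, h \in tangent (pt e t) /\ `|m| = `|slope f (pt e t) h| &
    forall u, a <= u <= b -> f (pt e u) <= f (pt e t) + m%:~R * (u - t).
Proof.
move=> rf a0 ab bl hord /andP[at_ tb].
have t0 := le_trans a0 at_; have tl := le_trans tb bl.
case: (ltgtP t b) tb => // [tb _|etb _]; last first.
  subst t; exists (- slope f (pt e b) (e, true)).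
    exists (e, true); rewrite normrN; split=> //.
    by apply: (starts_pt (h := (e, true)) _).1; rewrite /starts /= (le_lt_trans a0).
  move=> u hu; apply: le_trans (ord_ge0_concaveL rf a0 ab bl hord hu) _.
  by rewrite rmorphN /=; lra.
exists (slope f (pt e t) (e, false)).
  exists (e, false); split=> //.
  by apply: (starts_pt (h := (e, false)) _).1; rewrite /starts /= t0 (lt_le_trans tb).
move=> u /andP[au ub]; have [tu|ut] := leP t u.
  apply: (ord_ge0_concaveR rf t0 tb bl) => [w /andP[tw wb]|]; last by rewrite tu.
  by apply: hord; rewrite wb (le_lt_trans at_).
have at' := le_lt_trans au ut.
have ht : 0 < t < len e by rewrite (le_lt_trans a0 at') (lt_le_trans tb).
have := hord t; rewrite at' tb ord_inner // => /(_ isT) os.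
have := ord_ge0_concaveL (t := u) rf a0 at' tl; rewrite au (ltW ut) => hL.
have {hL} hL := hL _ isT; apply: le_trans (hL _) _.
  by move=> w /andP[aw wt]; apply: hord; rewrite aw (lt_trans wt).
rewrite lerD2l -(opprB t u) mulrN -mulNr ler_wpM2r ?subr_ge0 ?(ltW ut) //.
rewrite -mulrNz ler_int; move: os; clear; lia.
Qed.

End Slopes.

(** * Finite models and linear equivalence *)

Section Models.
Context {R : realType} {G : tropicalCurve R}.
Implicit Types (f g : tpoint G -> R) (p q : tpoint G) (e : edge G) (a b t : R).
Implicit Types (d : edge G -> seq R) (D : divisor G).

Definition is_model d := forall e, cut_list 0 (d e) (len e).

Definition points d : seq (tpoint G) :=
  [seq inl v | v <- enum (vertex G)] ++ [seq pt e t | e <- enum (edge G), t <- d e].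

Definition segments d e := segs 0 (d e) (len e).

Lemma pt_inj_inner e e' t t' : 0 < t < len e -> 0 < t' < len e' ->
  pt e t = pt e' t' -> e = e' /\ t = t'.
Proof.
move=> /pt_innerE[u -> <-] /pt_innerE[u' -> <-].
pose proj (x : tpoint G) := if x is inr y then (tag y, val (tagged y)) else (e, 0).
by move=> /(congr1 proj)[].
Qed.

Lemma inl_points d v : inl v \in points d.
Proof. by rewrite mem_cat map_f // mem_enum. Qed.

Lemma pt_points d e t : t \in d e -> pt e t \in points d.
Proof.
move=> h; rewrite mem_cat orbC (_ : _ \in _) //.
by apply/allpairsPdep; exists e, t; rewrite mem_enum.
Qed.

Lemma ptE e t : ~~ (0 < t < len e) ->
  pt e t = inl (if t <= 0 then src e else tgt e).
Proof. by move=> h; rewrite /pt insubN. Qed.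

Lemma mem_points_inner d e t : is_model d -> 0 < t < len e ->
  (pt e t \in points d) = (t \in d e).
Proof.
move=> hd ht; apply/idP/idP; last exact: pt_points.
rewrite mem_cat => /orP[/mapP[v _]|/allpairsPdep[e' [t' [_ ht' eq_pt]]]].
  by have [u -> _] := pt_innerE ht.
have [-> -> //] := pt_inj_inner ht (mem_cut_list (hd e') ht') eq_pt.
Qed.

Lemma cut_list_uniq a s l : cut_list a s l -> uniq s.
Proof.
rewrite /cut_list rcons_path => /andP[/path_sorted]; rewrite lt_sorted_uniq_le.
by case/andP.
Qed.

Lemma uniq_points d : is_model d -> uniq (points d).
Proof.
move=> hd; rewrite cat_uniq map_inj_uniq ?enum_uniq /=; last by move=> ? ? [].
apply/andP; split.
  apply/hasPn => p /allpairsPdep[e [t [_ /(mem_cut_list (hd e)) ht ->]]].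
  by have [u -> _] := pt_innerE ht; apply/mapP => -[].
apply: allpairs_uniq_dep; first exact: enum_uniq.
  by move=> e _; apply: cut_list_uniq (hd e).
move=> [e t] [e' t'] /allpairsPdep[x [y [_ hy [-> ->]]]].
move=> /allpairsPdep[x' [y' [_ hy' [-> ->]]]] /= E.
by have [-> ->] := pt_inj_inner (mem_cut_list (hd x) hy) (mem_cut_list (hd x') hy') E.
Qed.

Lemma segmentsP d e ab : is_model d -> ab \in segments d e ->
  [/\ 0 <= ab.1, ab.1 < ab.2, ab.2 <= len e,
      pt e ab.1 \in points d /\ pt e ab.2 \in points d &
      forall t, ab.1 < t < ab.2 -> pt e t \notin points d].
Proof.
move=> hd hab; have [a0 ab12 bl [m1 m2] hz] := segsP (hd e) hab.
split=> // [|t /andP[at_ tb]].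
  split.
    move: m1; rewrite inE => /orP[/eqP->|/pt_points//].
    by rewrite pt_src inl_points.
  move: m2; rewrite mem_rcons inE => /orP[/eqP->|/pt_points//].
  by rewrite pt_tgt inl_points.
rewrite mem_points_inner ?(le_lt_trans a0) ?(lt_le_trans tb) //.
by apply/negP => /hz; rewrite at_ tb.
Qed.

(** Double counting: a direction at a point of the model leads into exactly one segment, and a
    segment has two ends. *)
Lemma sum_flags (M : nmodType) d (F : tpoint G -> edge G * bool -> M) :
  is_model d ->
  \sum_(p <- points d) \sum_(h in tangent p) F p h =
  \sum_e \sum_(ab <- segments d e)
    (F (pt e ab.1) (e, false) + F (pt e ab.2) (e, true)).
Proof.
move=> hd; rewrite /points big_cat big_map big_enum /=.
pose endv (h : edge G * bool) := if h.2 then tgt h.1 else src h.1.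
have -> : \sum_(v : vertex G) \sum_(h in tangent (inl v)) F (inl v) h =
    \sum_e (F (pt e 0) (e, false) + F (pt e (len e)) (e, true)).
  rewrite [LHS](_ : _ = \sum_h F (inl (endv h)) h).
    rewrite (eq_bigr (fun h : edge G * bool => F (inl (endv (h.1, h.2))) (h.1, h.2))).
      rewrite -(pair_bigA _ (fun e (b : bool) => F (inl (endv (e, b))) (e, b))) /=.
      by apply: eq_bigr => e _; rewrite big_bool /= addrC pt_src pt_tgt.
    by case.
  rewrite [RHS](partition_big endv predT) //=; apply: eq_bigr => v _.
  apply: eq_big => [h|h]; first by rewrite inE.
  by rewrite inE => /eqP <-.
rewrite big_allpairs_dep big_enum.
transitivity (\sum_e ((F (pt e 0) (e, false) + F (pt e (len e)) (e, true)) +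
    \sum_(t <- d e) \sum_(h in tangent (pt e t)) F (pt e t) h)).
  by rewrite [RHS]big_split; congr (_ + _); apply: eq_bigl.
apply: eq_bigr => e _; rewrite [RHS]big_split /=.
rewrite (big_segs_left (fun x => F (pt e x) (e, false))).
rewrite (big_segs_right (fun x => F (pt e x) (e, true))).
rewrite big_cons big_rcons /= [in RHS](addrC _ (F (pt e (len e)) _)) [RHS]addrACA; congr (_ + _).
rewrite -big_split big_seq_cond [RHS]big_seq_cond; apply: eq_bigr => t /andP[ht _].
by rewrite sum_tangent_inner //; exact: mem_cut_list (hd e) ht.
Qed.

Lemma model_exists (s : edge G -> seq R) (T : seq (tpoint G)) :
  exists d, [/\ is_model d, {subset T <= points d} &
    forall e ab, ab \in segments d e -> forall z, z \in s e -> ~~ (ab.1 < z < ab.2)].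
Proof.
(* The parameters of the points of [T] are used as cuts on all edges at once, which does no harm;
   the value 0 given to vertices is discarded by [sort_cuts]. *)
pose par (x : tpoint G) : R := if x is inr y then val (tagged y) else 0.
exists (fun e => sort_cuts 0 (s e ++ [seq par x | x <- T]) (len e)).
have hd : is_model (fun e => sort_cuts 0 (s e ++ [seq par x | x <- T]) (len e)).
  by move=> e; apply: sort_cutsP; apply: len_gt0.
split=> // [x xT|e ab hab z zs].
  case: x xT => [v _|[e u] xT]; first exact: inl_points.
  rewrite -pt_inner; apply: pt_points.
  rewrite mem_sort_cuts (valP u) mem_cat orbC.
  by have /= -> := map_f par xT.
have [a0 ab12 bl _ hz] := segsP (hd e) hab; apply/negP => /andP[h1 h2].
have /hz : z \in sort_cuts 0 (s e ++ [seq par x | x <- T]) (len e).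
  by rewrite mem_sort_cuts mem_cat zs (le_lt_trans a0) ?(lt_le_trans h2).
by rewrite h1 h2.
Qed.

Definition adapted f d := forall e ab, ab \in segments d e ->
  int_affine (fun t => f (pt e t)) ab.1 ab.2.

Lemma adapted_model f (s : edge G -> seq R) (T : seq (tpoint G)) :
  rational_function f ->
  exists d, [/\ is_model d, {subset T <= points d}, adapted f d &
    forall e ab, ab \in segments d e -> forall z, z \in s e -> ~~ (ab.1 < z < ab.2)].
Proof.
move=> /rational_functionP rf; have [s' hs'] := choice rf.
have [d [hd hT hz]] := model_exists (fun e => s' e ++ s e) T.
exists d; split=> // [e ab hab|e ab hab z zs].
  have [a0 ab12 bl _ _] := segmentsP hd hab; apply: hs' => // z zs.
  by apply: hz hab _ _; rewrite mem_cat zs.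
by apply: hz hab _ _; rewrite mem_cat zs orbT.
Qed.

Lemma adapted_slopes f d e ab : is_model d -> adapted f d -> ab \in segments d e ->
  let m := slope f (pt e ab.1) (e, false) in
  slope f (pt e ab.2) (e, true) = - m /\
  forall t, ab.1 <= t <= ab.2 -> f (pt e t) = f (pt e ab.1) + m%:~R * (t - ab.1).
Proof.
move=> hd hf hab m; have [a0 ab12 bl _ _] := segmentsP hd hab.
have [m' [c hm]] := hf _ _ hab.
have em : m = m' by apply: slope_affineR hm.
rewrite em; split; first exact: slope_affineL hm.
by move=> t ht; rewrite !hm ?lexx ?(ltW ab12) //; ring.
Qed.

Lemma seg_of_inner d e t : is_model d -> 0 < t < len e -> pt e t \notin points d ->
  exists2 ab, ab \in segments d e & ab.1 < t < ab.2.
Proof.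
move=> hd ht hp; have h0 : 0 <= t <= len e by case/andP: ht => /ltW -> /ltW ->.
have [ab hab /andP[h1 h2]] := segs_cover (hd e) h0.
exists ab => //; have [_ _ _ [m1 m2] _] := segmentsP hd hab.
by rewrite !lt_neqAle h1 h2 !andbT; apply/andP; split;
   apply/eqP => E; move: hp; rewrite -?E ?m1 // E m2.
Qed.

Lemma ord_affine f e a b u : 0 <= a -> b <= len e -> a < u < b ->
  int_affine (fun t => f (pt e t)) a b -> ord f (pt e u) = 0.
Proof.
move=> a0 bl /andP[au ub] hf.
have [m [c hm]] := hf; rewrite ord_inner ?(le_lt_trans a0) ?(lt_le_trans ub) //.
rewrite (@slope_affineR _ _ f e u b m c) ?(ltW (le_lt_trans a0 au)) //.
  rewrite (@slope_affineL _ _ f e a u m c) ?(ltW (lt_le_trans ub bl)) //.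
    by rewrite subrr oppr0.
  by move=> t /andP[h1 h2]; rewrite hm // h1 (le_trans h2 (ltW ub)).
by move=> t /andP[h1 h2]; rewrite hm // h2 (le_trans (ltW au)).
Qed.

Lemma ord_outside f d p : is_model d -> adapted f d -> p \notin points d ->
  ord f p = 0.
Proof.
move=> hd hf; case: p => [v|[e u]]; first by rewrite inl_points.
rewrite -pt_inner => hp; have [ab hab hu] := seg_of_inner hd (valP u) hp.
have [a0 _ bl _ _] := segmentsP hd hab.
exact: ord_affine a0 bl hu (hf _ _ hab).
Qed.

Lemma sum_ord f d : is_model d -> adapted f d -> \sum_(p <- points d) ord f p = 0.
Proof.
move=> hd hf; rewrite /ord sumrN sum_flags // big1 ?oppr0 // => e _.
rewrite big_seq_cond big1 // => ab /andP[hab _].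
by have [-> _] := adapted_slopes hd hf hab; rewrite subrr.
Qed.

Lemma sum_freegE (S : seq (tpoint G)) (F : tpoint G -> int) p : uniq S ->
  coeff p (\sum_(x <- S) << F x *g x >>) = if p \in S then F p else 0.
Proof.
move=> uS; rewrite raddf_sum /=; under eq_bigr do rewrite coeffU.
case: ifPn => pS.
  by rewrite (bigD1_seq p) //= eqxx mulr1 big1 ?addr0 // => x /negbTE ->; rewrite mulr0.
rewrite big_seq_cond big1 // => x /andP[xS _]; case: eqP => [E|_]; last by rewrite mulr0.
by move: pS; rewrite -E xS.
Qed.

Lemma deg_sum_freeg (S : seq (tpoint G)) (F : tpoint G -> int) :
  deg (\sum_(x <- S) << F x *g x >>) = \sum_(x <- S) F x.
Proof. by rewrite raddf_sum /=; apply: eq_bigr => x _; rewrite degU. Qed.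

Lemma divisorP D D' : (forall p, coeff p D = coeff p D') -> D = D'.
Proof. by move=> h; apply/eqP/freeg_eqP. Qed.

Lemma degE D (S : seq (tpoint G)) : uniq S -> (forall p, p \notin S -> coeff p D = 0) ->
  deg D = \sum_(p <- S) coeff p D.
Proof.
move=> uS h; rewrite -(deg_sum_freeg S (fun x => coeff x D)); congr deg.
by apply: divisorP => p; rewrite (sum_freegE (fun x => coeff x D)) //; case: ifPn => // /h.
Qed.

Lemma principalP f : rational_function f ->
  exists2 P : divisor G, deg P = 0 & forall p, coeff p P = ord f p.
Proof.
move=> rf; have [d [hd _ hf _]] := adapted_model (fun=> [::]) [::] rf.
exists (\sum_(x <- points d) << ord f x *g x >>).
  by rewrite deg_sum_freeg sum_ord.
move=> p; rewrite (sum_freegE (ord f)) ?uniq_points //; case: ifPn => // /(ord_outside hd hf).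
by move->.
Qed.

Lemma lin_equiv_deg D D' : lin_equiv D D' -> deg D = deg D'.
Proof.
move=> [f rf h]; have [P dP hP] := principalP rf.
have -> : D = D' + P; last by rewrite degD dP addr0.
by apply: divisorP => p; rewrite coeffD hP -h coeffB addrC subrK.
Qed.

Lemma lin_equiv_refl D : lin_equiv D D.
Proof.
exists (fun=> 0) => [|p]; first exact: rational_function_cst.
by rewrite ord_cst subrr coeff0.
Qed.

Lemma lin_equiv_sym D D' : lin_equiv D D' -> lin_equiv D' D.
Proof.
move=> [f rf h]; exists (fun x => - f x) => [|p]; first exact: rational_functionN.
by rewrite ordN // -h !coeffB opprB.
Qed.

Lemma lin_equiv_trans D' D D'' : lin_equiv D D' -> lin_equiv D' D'' -> lin_equiv D D''.
Proof.
move=> [f rf h] [g rg k]; exists (fun x => f x + g x) => [|p].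
  exact: rational_functionD.
by rewrite ordD // -h -k !coeffB; ring.
Qed.

Lemma lin_equivD D1 D2 E1 E2 : lin_equiv D1 E1 -> lin_equiv D2 E2 ->
  lin_equiv (D1 + D2) (E1 + E2).
Proof.
move=> [f rf h] [g rg k]; exists (fun x => f x + g x) => [|p].
  exact: rational_functionD.
by rewrite ordD // -h -k !coeffB !coeffD; ring.
Qed.

Lemma lin_equivN D E : lin_equiv D E -> lin_equiv (- D) (- E).
Proof.
move=> [f rf h]; exists (fun x => - f x) => [|p]; first exact: rational_functionN.
by rewrite ordN // -h !coeffB !coeffN; ring.
Qed.

Lemma lin_equiv_addr D E F : lin_equiv D E -> lin_equiv (D + F) (E + F).
Proof. by move=> h; apply: lin_equivD h (lin_equiv_refl _). Qed.

Definition eff_equiv D := exists2 D', effective D' & lin_equiv D D'.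

Lemma eff_equiv_lin D E : lin_equiv D E -> eff_equiv E -> eff_equiv D.
Proof. by move=> h [F eF EF]; exists F => //; exact: lin_equiv_trans EF. Qed.

Lemma effectiveD D E : effective D -> effective E -> effective (D + E).
Proof. by move=> h k p; rewrite coeffD addr_ge0. Qed.

Lemma effectiveU (k : int) p : 0 <= k -> effective << k *g p >>.
Proof. by move=> k0 x; rewrite coeffU mulr_ge0. Qed.

Lemma eff_equivD D E : eff_equiv D -> effective E -> eff_equiv (D + E).
Proof.
move=> [F eF h] eE; exists (F + E); first exact: effectiveD.
exact: lin_equiv_addr.
Qed.

Lemma deg_effective D : effective D -> 0 <= deg D.
Proof.
move=> h; rewrite (@degE D (dom D)) ?uniq_dom //; first by rewrite sumr_ge0.
by move=> p /coeff_outdom.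
Qed.

Lemma deg_eff_equiv D : eff_equiv D -> 0 <= deg D.
Proof. by move=> [E /deg_effective h /lin_equiv_deg ->]. Qed.

End Models.

(** * The least function *)

Section LeastFunction.
Context {R : realType} {G : tropicalCurve R}.
Implicit Types (f g : tpoint G -> R) (p q : tpoint G) (e : edge G) (a b t : R).
Implicit Types (d : edge G -> seq R) (D : divisor G).

Lemma flag_segment d p h : is_model d -> p \in points d -> h \in tangent p ->
  exists2 ab, ab \in segments d h.1 & coord p h = if h.2 then ab.2 else ab.1.
Proof.
move=> hd hp /tangentP[]; set t := coord p h => ht ep.
have [t0|t0] := eqVneq t 0.
  move: ht; rewrite /starts t0 ltxx /=; case: h.2 => // _.
  have /mapP[ab hab ->] : 0 \in [seq ab.1 | ab <- segments d h.1].
    by rewrite map_segs_left inE eqxx.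
  by exists ab.
have [tl|tl] := eqVneq t (len h.1).
  move: ht; rewrite /starts tl ltxx andbF; case: h.2 => // _.
  have /mapP[ab hab ->] : len h.1 \in [seq ab.2 | ab <- segments d h.1].
    by rewrite map_segs_right mem_rcons inE eqxx.
  by exists ab.
have t0l : 0 < t < len h.1.
  rewrite !lt_neqAle (eq_sym 0) t0 tl /=; move: ht; rewrite /starts.
  by case: h.2 => /andP[h1 h2]; [rewrite (ltW h1) | rewrite h1 (ltW h2)].
have td : t \in d h.1 by rewrite -mem_points_inner // -ep.
case: h.2.
  have /mapP[ab hab ->] : t \in [seq ab.2 | ab <- segments d h.1].
    by rewrite map_segs_right mem_rcons inE td orbT.
  by exists ab.
have /mapP[ab hab ->] : t \in [seq ab.1 | ab <- segments d h.1].
  by rewrite map_segs_left inE td orbT.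
by exists ab.
Qed.

Lemma sum_segments_ge (T : edge G -> R * R -> int) d e ab :
  (forall e ab, ab \in segments d e -> 0 <= T e ab) -> ab \in segments d e ->
  T e ab <= \sum_e \sum_(ab <- segments d e) T e ab.
Proof.
move=> T0 hab; rewrite (bigD1 e) //= (big_rem ab hab) /= -addrA lerDl addr_ge0 //.
  by rewrite big_seq_cond sumr_ge0 // => x /andP[/mem_rem hx _]; apply: T0.
by rewrite sumr_ge0 // => e' _; rewrite big_seq_cond sumr_ge0 // => x /andP[hx _]; apply: T0.
Qed.

(* The chips crossing a level set of f come from below it, and are chips of D. *)
Lemma slope_bound D f p h : effective D -> rational_function f ->
  (forall x, 0 <= coeff x D + ord f x) -> h \in tangent p ->
  `|slope f p h| <= deg D.
Proof.
move=> eD rf hf hp.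
have [d [hd hT ha _]] := adapted_model (fun=> [::]) (p :: dom D) rf.
have pd : p \in points d by apply: hT; rewrite inE eqxx.
have [ab hab ec] := flag_segment hd pd hp.
have [_ ep] := tangentP hp; rewrite ec in ep.
pose m e (xy : R * R) := slope f (pt e xy.1) (e, false).
have -> : `|slope f p h| = `|m h.1 ab|.
  have [sl _] := adapted_slopes hd ha hab; move: sl ep => /=; rewrite /m.
  by case: h {hp ec hab} => e [] /= sl ->; rewrite ?sl ?normrN.
set e := h.1 in hab *.
pose c := Num.min (f (pt e ab.1)) (f (pt e ab.2)).
(* [T] is the slope with which f leaves the sublevel set f <= c through a segment. It is never
   negative and equals |m| on [ab]; regrouped by points, the total is minus the sum of [ord f] over
   the sublevel set, hence at most deg D. *)
pose T e (xy : R * R) := (if f (pt e xy.1) <= c then m e xy else 0) -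
  (if f (pt e xy.2) <= c then m e xy else 0).
have Tval e' xy : xy \in segments d e' ->
    f (pt e' xy.2) = f (pt e' xy.1) + (m e' xy)%:~R * (xy.2 - xy.1) /\ xy.1 < xy.2.
  move=> hxy; have [_ h2] := adapted_slopes hd ha hxy.
  have [_ lt12 _ _ _] := segmentsP hd hxy; split=> //.
  by apply: h2; rewrite ltW //=.
have T0 e' xy : xy \in segments d e' -> 0 <= T e' xy.
  move=> hxy; have [E lt12] := Tval _ _ hxy; rewrite /T.
  case: (leP (f (pt e' xy.1))) => h1; case: (leP (f (pt e' xy.2))) => h2; rewrite ?subr0 ?subrr //.
    have : 0 < (m e' xy)%:~R * (xy.2 - xy.1) by rewrite E in h2; lra.
    by rewrite pmulr_lgt0 ?subr_gt0 // ltr0z => /ltW.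
  have : (m e' xy)%:~R * (xy.2 - xy.1) < 0 by rewrite E in h2; lra.
  by rewrite pmulr_llt0 ?subr_gt0 // ltrz0 sub0r oppr_ge0 => /ltW.
have Tm : `|m e ab| <= T e ab.
  have [E lt12] := Tval _ _ hab; rewrite /T /c !le_min !lexx andbT /=.
  have [m0|m0|->] := ltgtP (m e ab) 0; last by rewrite normr0 !if_same subrr.
    have : (m e ab)%:~R * (ab.2 - ab.1) < 0 by rewrite pmulr_llt0 ?subr_gt0 // ltrz0.
    move=> lt0; have lt1 : f (pt e ab.2) < f (pt e ab.1) by lra.
    by rewrite leNgt lt1 (ltW lt1) /= sub0r ltr0_norm.
  have : 0 < (m e ab)%:~R * (ab.2 - ab.1) by rewrite pmulr_lgt0 ?subr_gt0 // ltr0z.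
  move=> lt0; have lt1 : f (pt e ab.1) < f (pt e ab.2) by lra.
  by rewrite (ltW lt1) leNgt lt1 /= subr0 gtr0_norm.
apply: le_trans Tm _; apply: le_trans (sum_segments_ge T0 hab) _.
pose F x (h : edge G * bool) := if f x <= c then slope f x h else 0.
have -> : \sum_e \sum_(ab <- segments d e) T e ab =
    \sum_(x <- points d) \sum_(h in tangent x) F x h.
  rewrite sum_flags //; apply: eq_bigr => e' _.
  rewrite big_seq_cond [RHS]big_seq_cond; apply: eq_bigr => xy /andP[hxy _].
  have [sl _] := adapted_slopes hd ha hxy; rewrite /T /F sl.
  by case: ifP => _; case: ifP; rewrite ?subr0.
rewrite (@degE _ _ D (points d)) ?uniq_points //; last first.
  move=> x hx; apply/coeff_outdom; apply: contra hx => xD.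
  by apply: hT; rewrite inE xD orbT.
apply: ler_sum => x _; rewrite /F; case: (f x <= c); last by rewrite big1_eq; exact: eD.
by have := hf x; rewrite /ord; lia.
Qed.

Lemma lipschitz_glue (phi : R -> R) (C : R) a s l : cut_list a s l ->
  (forall ab, ab \in segs a s l -> forall u v, ab.1 <= u -> u <= v -> v <= ab.2 ->
     `|phi u - phi v| <= C * (v - u)) ->
  forall u v, a <= u -> u <= v -> v <= l -> `|phi u - phi v| <= C * (v - u).
Proof.
rewrite /cut_list; elim: s a => [|z s IH] a /=.
  by move=> _ h u v; apply: (h (a, l)); rewrite inE.
move=> /andP[az hs] h u v au uv vl; have h1 := h (a, z); rewrite inE eqxx /= in h1.
have {IH} h2 := IH _ hs; have [vz|zv] := leP v z; first exact: h1.
have {} h2 : forall u v, z <= u -> u <= v -> v <= l -> `|phi u - phi v| <= C * (v - u).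
  by apply: h2 => ab hab; apply: h; rewrite inE hab orbT.
have [zu|uz] := leP z u; first exact: h2.
apply: le_trans (ler_distD (phi z) _ _) _.
have -> : C * (v - u) = C * (z - u) + C * (v - z) by ring.
by apply: lerD; [apply: h1 => //; exact: ltW | apply: h2 => //; exact: ltW].
Qed.

Lemma lipschitz_slope f (C : int) p q : rational_function f -> 0 <= C ->
  (forall x h, h \in tangent x -> `|slope f x h| <= C) ->
  `|f p - f q| <= (C + 1)%:~R * pdist p q.
Proof.
move=> rf C0 hC; have [d [hd _ ha _]] := adapted_model (fun=> [::]) [::] rf.
(* Adding 1 makes the constant positive even for C = 0, so that f can be divided by it and
   [lip_pdist] applied. *)
have C1 : 0 < (C + 1)%:~R :> R by rewrite ltr0z; lia.
have hseg e u v : 0 <= u -> u <= v -> v <= len e ->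
    `|f (pt e u) - f (pt e v)| <= (C + 1)%:~R * (v - u).
  apply: (@lipschitz_glue (fun t => f (pt e t)) _ _ _ _ (hd e)).
  move=> ab hab {}u {}v au uv vb.
  have [a0 ab12 bl _ _] := segmentsP hd hab.
  have [_ E] := adapted_slopes hd ha hab.
  rewrite (E u) ?au ?(le_trans uv) // (E v) ?vb ?(le_trans au) //.
  set m := slope _ _ _.
  have -> : f (pt e ab.1) + m%:~R * (u - ab.1) - (f (pt e ab.1) + m%:~R * (v - ab.1)) =
    - (m%:~R * (v - u)) by ring.
  rewrite normrN normrM (ger0_norm (_ : 0 <= v - u)) ?subr_ge0 //.
  apply: ler_wpM2r; rewrite ?subr_ge0 // -intr_norm ler_int.
  apply: le_trans (hC (pt e ab.1) (e, false) _) _; last by lia.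
  by apply: (starts_pt (h := (e, false)) _).1; rewrite /starts /= a0 (lt_le_trans ab12).
have := @lip_pdist R G (fun x => f x / (C + 1)%:~R).
rewrite -ler_pdivrMl // mulrC => H.
have -> : `|f p - f q| / (C + 1)%:~R = `|f p / (C + 1)%:~R - f q / (C + 1)%:~R|.
  by rewrite -mulrBl normrM normfV (gtr0_norm C1).
apply: H => e s t /andP[s0 sl] /andP[t0 tl].
rewrite -mulrBl normrM normfV (gtr0_norm C1) ler_pdivrMr // mulrC.
have [st|/ltW ts] := leP s t.
  by rewrite (distrC s) (ger0_norm (_ : 0 <= t - s)) ?subr_ge0 // hseg.
by rewrite distrC (ger0_norm (_ : 0 <= s - t)) ?subr_ge0 // hseg.
Qed.

(** The point is uniformity: [eta] is the length of a segment free of chips of [D] and does not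
    depend on [f], so the bound can be compared with an infimum over all [f]. *)
Lemma concave_ray D p h : h \in tangent p ->
  exists2 eta, 0 < eta & forall f, rational_function f ->
    (forall x, 0 <= coeff x D + ord f x) -> forall t, 0 <= t < eta ->
    f (ray p h t) <= f p + (slope f p h)%:~R * t.
Proof.
move=> hp; have [d [hd hT _]] := model_exists (fun=> [::]) (p :: dom D).
have pd : p \in points d by apply: hT; rewrite inE eqxx.
have [ab hab ec] := flag_segment hd pd hp.
have [a0 ab12 bl _ hout] := segmentsP hd hab.
have [hs ep] := tangentP hp; exists (ab.2 - ab.1); first by rewrite subr_gt0.
move=> f rf hf t /andP[t0 tab].
have hord u : ab.1 < u < ab.2 -> 0 <= ord f (pt h.1 u).
  move=> /hout hu; have := hf (pt h.1 u); rewrite coeff_outdom ?add0r //.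
  by apply: contra hu => hu; apply: hT; rewrite inE hu orbT.
rewrite /ray ec; rewrite ec in ep; rewrite {}ep.
case: h {hp hs} ec hab a0 ab12 bl hout hord => e [] /= _ hab a0 ab12 bl hout hord.
  apply: le_trans (ord_ge0_concaveL (t := ab.2 - t) rf a0 ab12 bl hord _) _.
    by apply/andP; split; lra.
  by rewrite lerD2l (_ : ab.2 - (ab.2 - t) = t) //; ring.
apply: le_trans (ord_ge0_concaveR (t := ab.1 + t) rf a0 ab12 bl hord _) _.
  by apply/andP; split; lra.
by rewrite lerD2l (_ : ab.1 + t - ab.1 = t) //; ring.
Qed.

Lemma pos_lower_bound (T : eqType) (s : seq T) (F : T -> R) :
  (forall x, x \in s -> 0 < F x) -> exists2 eps, 0 < eps & forall x, x \in s -> eps <= F x.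
Proof.
elim: s => [|y s IH] h; first by exists 1.
have [|eps eps0 heps] := IH; first by move=> x xs; apply: h; rewrite inE xs orbT.
exists (Num.min eps (F y)); first by rewrite lt_min eps0 h // inE eqxx.
by move=> x; rewrite inE ge_min => /orP[/eqP->|/heps ->//]; rewrite lexx orbT.
Qed.

(** Two supporting lines with the same slope coincide, so [phi] is the minimum of at most one line
    for each slope between -C and C. A slope that supports nowhere contributes no line to [L]. *)
Lemma supergradient_pl (phi : R -> R) (C : nat) a b :
  (forall t, a <= t <= b -> exists2 m : int, `|m| <= C%:Z &
     forall u, a <= u <= b -> phi u <= phi t + m%:~R * (u - t)) ->
  int_pl phi a b.
Proof.
move=> hsup; pose sup_at (m : int) t := a <= t <= b /\
  forall u, a <= u <= b -> phi u <= phi t + m%:~R * (u - t).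
have /choice[tau htau] : forall m, exists t, (exists u, sup_at m u) -> sup_at m t.
  move=> m; have [[u hu]|h] := pselect (exists u, sup_at m u); first by exists u.
  by exists 0.
pose L := [seq (m, phi (tau m) - m%:~R * tau m) |
  m <- [seq i%:Z - C%:Z | i <- iota 0 (C + C).+1] & `[< exists u, sup_at m u >]].
apply: (@int_pl_min _ _ _ _ L) => [t ht|t mc ht /mapP[m]].
  have [m mC hm] := hsup t ht; have ex : exists u, sup_at m u by exists t; split.
  exists (m, phi (tau m) - m%:~R * tau m).
    apply: map_f; rewrite mem_filter; apply/andP; split; first exact/asboolP.
    apply/mapP; exists `|(m + C%:Z)%R|%N; last by lia.
    by rewrite mem_iota; lia.
  have [hin hs] := htau m ex; apply/le_anti; rewrite /=.
  by have := hs t ht; have := hm _ hin; lra.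
rewrite mem_filter => /andP[/asboolP /htau[_ hs] _] ->/=.
by have := hs t ht; lra.
Qed.

(** * The least function attached to an effective divisor and a base point *)

Section Fixed.
Variables (D : divisor G) (q : tpoint G).
Hypothesis eD : effective D.

Definition normalized f := [/\ rational_function f, f q = 0, forall x, f x <= 0 &
  forall x, 0 <= coeff x D + ord f x].

(** A value f(x) < 0 = f(q) reflects chips moved towards [q]; taking f as low as possible
    corresponds to passing to the q-reduced divisor of [D]. *)
Definition least_function x := inf [set f x | f in normalized].

Lemma normalized0 : normalized (fun=> 0).
Proof.
split=> // [|x]; first exact: rational_function_cst.
by rewrite ord_cst addr0.
Qed.

Lemma has_inf_normalized x : has_inf [set f x | f in normalized].
Proof.
split; first by exists 0; exists (fun=> 0) => //; exact: normalized0.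
(* From f(q) = 0 and the slope bound deg D, through the constant of [lipschitz_slope]. *)
exists (- ((deg D + 1)%:~R * pdist q x)) => _ [f [rf fq _ hf] <-].
have := lipschitz_slope q x rf (deg_effective eD) (fun y h => slope_bound eD rf hf).
by rewrite fq sub0r normrN; have := ler_norm (- f x); rewrite normrN; lra.
Qed.

Lemma least_function_le f x : normalized f -> least_function x <= f x.
Proof.
by move=> nf; apply: ge_inf; [case: (has_inf_normalized x) | exists f].
Qed.

Lemma least_function_adherent x (eps : R) : 0 < eps ->
  exists2 f, normalized f & f x < least_function x + eps.
Proof.
by move=> e0; have [_ [f nf <-] h] := inf_adherent e0 (has_inf_normalized x); exists f.
Qed.

(** If no slope m between -deg D and deg D supported the infimum at [t], each m would fail at some
    [w m] by a positive amount, and by at least one common [eps]. A normalized f within [eps] of the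
    infimum at [t] has a supporting slope m there, which forces it below the infimum at [w m]. *)
Lemma least_function_rational : rational_function least_function.
Proof.
have [d [hd hT _]] := model_exists (fun=> [::]) (dom D).
apply/rational_functionP => e; apply: int_pl_glue (hd e) _ => ab hab.
have [a0 ab12 bl _ hout] := segmentsP hd hab.
pose C := `|deg D|%N; have CE : C%:Z = deg D by rewrite gez0_abs // deg_effective.
apply: (@supergradient_pl _ C) => t ht; apply: contrapT => hno.
pose L := [seq i%:Z - C%:Z | i <- iota 0 (C + C).+1].
have memL (m : int) : `|m| <= C%:Z -> m \in L.
  move=> mC; apply/mapP; exists `|(m + C%:Z)%R|%N; last by lia.
  by rewrite mem_iota; lia.
have /choice[w hw] : forall m : int, exists u, `|m| <= C%:Z -> ab.1 <= u <= ab.2 /\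
    least_function (pt e t) + m%:~R * (u - t) < least_function (pt e u).
  move=> m; have [mC|mC] := boolP (`|m| <= C%:Z); last by exists 0.
  apply: contrapT => h; apply: hno; exists m => // u hu; rewrite leNgt.
  by apply/negP => hlt; apply: h; exists u.
pose M := [seq m <- L | `|m| <= C%:Z].
have [|eps eps0 heps] := @pos_lower_bound _ M (fun m =>
    least_function (pt e (w m)) - (least_function (pt e t) + m%:~R * (w m - t))).
  by move=> m; rewrite mem_filter => /andP[/hw[_ h] _]; rewrite subr_gt0.
have [f nf hf] := least_function_adherent (pt e t) eps0; have [rf fq f0 hord] := nf.
have hordab u : ab.1 < u < ab.2 -> 0 <= ord f (pt e u).
  move=> /hout hu; have := hord (pt e u); rewrite coeff_outdom ?add0r //.
  by apply: contra hu; apply: hT.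
have [m [h [hh em]] hm] := ord_ge0_supergradient rf a0 ab12 bl hordab ht.
have mC : `|m| <= C%:Z by rewrite em CE; exact: slope_bound.
have [hin _] := hw m mC; have := hm _ hin; have := least_function_le (pt e (w m)) nf.
have := heps m; rewrite mem_filter mC memL // => /(_ isT); lra.
Qed.

Lemma least_functionP : normalized least_function.
Proof.
have rs := least_function_rational; split=> // [|x|p].
- apply/le_anti/andP; split; first exact: (least_function_le q normalized0).
  apply: lb_le_inf; first by case: (has_inf_normalized q).
  by move=> _ [f [_ -> _ _] <-].
- exact: (least_function_le x normalized0).
have /choice[w hw] : forall h, exists t, h \in tangent p -> [/\ 0 < t,
    least_function (ray p h t) = least_function p + (slope least_function p h)%:~R * t &
    forall f, normalized f -> f (ray p h t) <= f p + (slope f p h)%:~R * t].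
  move=> h; have [hp|_] := boolP (h \in tangent p); last by exists 0.
  have [d1 d10 h1] := slopeP rs hp; have [d2 d20 h2] := concave_ray D hp.
  exists (Num.min d1 d2 / 2) => _.
  have m0 : 0 < Num.min d1 d2 by rewrite lt_min d10.
  have [m1 m2] : Num.min d1 d2 <= d1 /\ Num.min d1 d2 <= d2.
    by rewrite !ge_min !lexx orbT.
  split=> [||f [rf _ _ hf]]; first by lra.
    by apply: (h1 _ _).2; apply/andP; split; lra.
  by apply: h2 => //; apply/andP; split; lra.
(* An error at [p] smaller than every test length [w h] disturbs the comparison of slopes by less
   than 1. By integrality no slope of the least function at [p] exceeds that of f, so its [ord] is
   at least that of f. *)
have [|eps eps0 heps] := @pos_lower_bound _ (enum (tangent p)) w.
  by move=> h; rewrite mem_enum => /hw[].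
have [f nf hf] := least_function_adherent p eps0; have [_ _ _ hord] := nf.
apply: le_trans (hord p) _; rewrite lerD2l /ord lerN2; apply: ler_sum => h hp.
have [t0 e1 e2] := hw h hp; have {} heps : eps <= w h by apply: heps; rewrite mem_enum.
have l1 := e2 f nf; have l2 := least_function_le (ray p h (w h)) nf.
rewrite -ltzD1 -(ltr_int R) -(ltr_pM2r t0) rmorphD /= mulrDl mul1r.
by rewrite e1 in l2; lra.
Qed.

End Fixed.
End LeastFunction.

(** * Burning *)

Section Burning.
Context {R : realType} {G : tropicalCurve R}.
Implicit Types (f g : tpoint G -> R) (p q v : tpoint G) (e : edge G) (a b t : R).
Implicit Types (d : edge G -> seq R) (D : divisor G) (B U : pred (tpoint G)).
Implicit Types (tau : tpoint G -> int).

Lemma eff_equivP D : eff_equiv D <->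
  exists2 f, rational_function f & forall x, 0 <= coeff x D + ord f x.
Proof.
split=> [[E eE [f rf hf]]|[f rf hf]].
  exists (fun x => - f x) => [|x]; first exact: rational_functionN.
  by rewrite ordN // -hf coeffB opprB addrC subrK.
have [P _ hP] := principalP rf.
exists (D + P) => [x|]; first by rewrite coeffD hP.
exists (fun x => - f x) => [|x]; first exact: rational_functionN.
by rewrite ordN // -hP !coeffB !coeffD; ring.
Qed.

Lemma slope_le f p h (m : int) (r : R) : rational_function f -> h \in tangent p ->
  0 < r -> (forall t, 0 < t < r -> f (ray p h t) <= f p + m%:~R * t) ->
  slope f p h <= m.
Proof.
move=> rf hp r0 hr; have [r' r0' hr'] := slopeP rf hp.
have m0 : 0 < Num.min r r' by rewrite lt_min r0.
have [m1 m2] : Num.min r r' <= r /\ Num.min r r' <= r' by rewrite !ge_min !lexx orbT.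
pose t := Num.min r r' / 2; have t0 : 0 < t by rewrite /t; lra.
have := hr t; rewrite t0 (hr' t _).2; last by apply/andP; rewrite /t; split; lra.
rewrite lerD2l ler_pM2r // ler_int; apply.
by rewrite /t; lra.
Qed.

Lemma ord_ge0_max f p : rational_function f -> (forall x, f x <= f p) -> 0 <= ord f p.
Proof.
move=> rf hmax; rewrite /ord oppr_ge0 sumr_le0 // => h hp.
by apply: (slope_le rf hp ltr01) => t _; rewrite mul0r addr0.
Qed.

(** A line of slope [m] above f and touching it at [t] bounds the two outgoing slopes by [m] and
    [- m]. *)
Lemma ord_ge0_inner f e a b t (m : int) : rational_function f -> 0 <= a ->
  b <= len e -> a < t < b ->
  (forall u, a <= u <= b -> f (pt e u) <= f (pt e t) + m%:~R * (u - t)) ->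
  0 <= ord f (pt e t).
Proof.
move=> rf a0 bl /andP[at_ tb] hm.
have ht : 0 < t < len e by rewrite (le_lt_trans a0) // (lt_le_trans tb).
have /andP[t0 tl] := ht.
have sR : starts (e, false) t by rewrite /starts /= tl ltW.
have sL : starts (e, true) t by rewrite /starts /= t0 ltW.
rewrite ord_inner // oppr_ge0.
have hR : slope f (pt e t) (e, false) <= m.
  apply: (slope_le rf (starts_pt sR).1 (_ : 0 < b - t)); first by rewrite subr_gt0.
  move=> w /andP[w0 wb]; rewrite (ray_pt w sR) /=.
  by apply: le_trans (hm _ _) _; [apply/andP; split; lra | rewrite lerD2l; lra].
have hL : slope f (pt e t) (e, true) <= - m.
  apply: (slope_le rf (starts_pt sL).1 (_ : 0 < t - a)); first by rewrite subr_gt0.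
  move=> w /andP[w0 wb]; rewrite (ray_pt w sL) /=.
  apply: le_trans (hm _ _) _; first by apply/andP; split; lra.
  by rewrite lerD2l rmorphN /=; lra.
by rewrite -(subrr m) lerD.
Qed.

Lemma sum_tangent (M : nmodType) d v (F : tpoint G -> edge G * bool -> M) :
  is_model d -> v \in points d ->
  \sum_(h in tangent v) F v h = \sum_e \sum_(ab <- segments d e)
    ((if pt e ab.1 == v then F (pt e ab.1) (e, false) else 0) +
     (if pt e ab.2 == v then F (pt e ab.2) (e, true) else 0)).
Proof.
move=> hd vd; rewrite -(sum_flags (fun p h => if p == v then F p h else 0)) //.
rewrite (bigD1_seq v) ?uniq_points //= [X in _ + X]big1 ?addr0 => [|p /negbTE ->].
  by rewrite eqxx.
by rewrite big1_eq.
Qed.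

(** The number of segment ends at [v] whose opposite end lies in [B]. For [B] the points before [v]
    in an order, this is the indegree of [v] when segments are oriented upwards. *)
Definition nflags d B v : int := \sum_e \sum_(ab <- segments d e)
  (((pt e ab.1 == v) && B (pt e ab.2))%:Z + ((pt e ab.2 == v) && B (pt e ab.1))%:Z).

Lemma nflags_ge0 d B v : 0 <= nflags d B v.
Proof. by rewrite /nflags !sumr_ge0 // => e _; rewrite sumr_ge0. Qed.

Lemma nflags_le d B U v : (forall u, B u -> U u) -> nflags d B v <= nflags d U v.
Proof.
move=> BU; apply: ler_sum => e _; apply: ler_sum => ab _; apply: lerD.
  by case: (_ == _) => //=; case: (boolP (B _)) => [/BU -> //|_].
by case: (_ == _) => //=; case: (boolP (B _)) => [/BU -> //|_].
Qed.

Lemma nflags_split d tau v : is_model d -> v \in points d ->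
  (forall e ab, ab \in segments d e -> tau (pt e ab.1) != tau (pt e ab.2)) ->
  nflags d (fun u => tau u < tau v) v + nflags d (fun u => tau v < tau u) v =
  (valence v)%:Z.
Proof.
move=> hd vd hsep.
have -> : (valence v)%:Z = \sum_(h in tangent v) 1%:Z by rewrite sumr_const /valence natz.
rewrite (sum_tangent (fun=> (fun=> 1%:Z)) hd vd) -big_split; apply: eq_bigr => e _.
rewrite -big_split big_seq_cond [RHS]big_seq_cond.
apply: eq_bigr => ab /andP[hab _] /=; have := hsep _ _ hab.
have [->|/negbTE E1] := eqVneq (pt e ab.1) v; have [->|/negbTE E2] := eqVneq (pt e ab.2) v.
- by rewrite eqxx.
- by rewrite ?eqxx ?E2 /=; case: ltgtP.
- by rewrite ?eqxx ?E1 /=; case: ltgtP.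
- by rewrite ?E1 ?E2.
Qed.

Definition moderator d tau : divisor G :=
  \sum_(v <- points d) << nflags d (fun u => tau u < tau v)%R v - 1 *g v >>.

Lemma coeff_moderator d tau v : is_model d -> coeff v (moderator d tau) =
  if v \in points d then nflags d (fun u => tau u < tau v) v - 1 else 0.
Proof.
by move=> hd; rewrite (sum_freegE (fun v => nflags d (fun u => tau u < tau v) v - 1))
  ?uniq_points.
Qed.

Definition separates d tau :=
  forall e ab, ab \in segments d e -> tau (pt e ab.1) != tau (pt e ab.2).

Lemma canonical_moderator d tau : is_model d -> separates d tau ->
  canonical G = moderator d tau + moderator d (fun u => - tau u).
Proof.
move=> hd hsep; apply: divisorP => v; rewrite coeffD !coeff_moderator // coeff_canonical.
case: ifPn => vd; last first.
  case: v vd => [v|[e x]]; first by rewrite inl_points.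
  by rewrite -pt_inner (valence_inner (valP x)) subrr.
rewrite -(nflags_split hd vd hsep).
have -> : nflags d (fun u => - tau u < - tau v) v = nflags d (fun u => tau v < tau u) v.
  by congr nflags; apply/funext => u; rewrite ltrN2.
by ring.
Qed.

Lemma sum1_seqz (T : Type) (s : seq T) : \sum_(x <- s) 1 = (size s)%:Z.
Proof. by elim: s => [|x s IH]; rewrite ?big_nil // big_cons IH -PoszD. Qed.

(** Each segment is counted once, at its larger end, and each cut adds one point and one segment to
    those of the graph. *)
Lemma deg_moderator d tau : is_model d -> separates d tau ->
  deg (moderator d tau) = #|edge G|%:Z - #|vertex G|%:Z.
Proof.
move=> hd hsep; rewrite deg_sum_freeg big_split /= sumrN.
have -> : \sum_(v <- points d) nflags d (fun u => tau u < tau v) v =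
    \sum_e (size (d e)).+1%:Z.
  rewrite exchange_big; apply: eq_bigr => e _.
  rewrite exchange_big /= -(size_segs 0 (d e) (len e)) -sum1_seqz.
  rewrite big_seq_cond [RHS]big_seq_cond; apply: eq_bigr => ab /andP[hab _].
  have [_ _ _ [m1 m2] _] := segmentsP hd hab; rewrite big_split /=.
  rewrite (bigD1_seq (pt e ab.1)) ?uniq_points //= eqxx [X in _ + X + _]big1 ?addr0; last first.
    by move=> v /negbTE; rewrite eq_sym => ->.
  rewrite (bigD1_seq (pt e ab.2)) ?uniq_points //= eqxx [X in _ + (_ + X)]big1 ?addr0; last first.
    by move=> v /negbTE; rewrite eq_sym => ->.
  by have := hsep _ _ hab; case: ltgtP.
rewrite sum1_seqz.
rewrite /points size_cat size_map -cardE size_allpairs_dep sumnE big_map big_enum /=.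
rewrite (eq_bigr (fun e => (size (d e))%:Z + 1)) => [|e _]; last by rewrite -addn1 PoszD.
rewrite big_split /= sumr_const PoszD opprD addrACA natz.
rewrite (_ : (\sum_(e in edge G) size (d e))%:Z = \sum_e (size (d e))%:Z).
  by ring.
by rewrite (big_morph Posz PoszD (erefl _)); apply: eq_bigl.
Qed.

Lemma lex_min_exists (s : seq (tpoint G)) f tau v0 : v0 \in s ->
  exists2 v, v \in s & forall u, u \in s -> f v < f u \/ f v = f u /\ tau v <= tau u.
Proof.
elim: s v0 => // w s IH v0 _; case: s IH => [_|w' s IH].
  by exists w => [|u]; rewrite inE // => /eqP ->; right.
have [v vs hv] := IH w' (mem_head _ _).
have [h|h] := pselect (f v < f w \/ f v = f w /\ tau v <= tau w).
  exists v => [|u]; rewrite inE; first by rewrite vs orbT.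
  by move=> /orP[/eqP -> //|/hv].
exists w => [|u]; first exact: mem_head.
have [h1|h1|h1] := ltgtP (f w) (f v).
- rewrite inE => /orP[/eqP ->|/hv]; first by right.
  by case=> [h2|[h2 _]]; left; [exact: lt_trans h2 | rewrite -h2].
- by case: h; left.
have h2 : tau w <= tau v by rewrite leNgt; apply/negP => h2; apply: h; right; rewrite h1 ltW.
rewrite inE => /orP[/eqP ->|/hv]; first by right.
rewrite h1 => -[h3|[h3 h4]]; first by left.
by right; split=> //; exact: le_trans h4.
Qed.

(* At the first point, in the order tau, of the minimum set of f, the function f
   increases towards all the smaller neighbours. *)
Lemma moderator_not_eff d tau : is_model d -> ~ eff_equiv (moderator d tau).
Proof.
move=> hd /eff_equivP[f rf hf].
have /card_gt0P[v0 _] := vertex_gt0 G.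
have [v vd hv] := lex_min_exists f tau (inl_points d v0).
have key : nflags d (fun u => tau u < tau v) v <= \sum_(h in tangent v) slope f v h.
  rewrite (sum_tangent (slope f) hd vd); apply: ler_sum => e _.
  rewrite big_seq_cond [leRHS]big_seq_cond; apply: ler_sum => ab /andP[hab _].
  have [a0 ab12 bl [m1 m2] hout] := segmentsP hd hab.
  have hord u : ab.1 < u < ab.2 -> 0 <= ord f (pt e u).
    by move=> /hout /negbTE hu; have := hf (pt e u); rewrite coeff_moderator // hu add0r.
  have hR := ord_ge0_concaveR (t := ab.2) rf a0 ab12 bl hord.
  have {hR} := hR; rewrite lexx (ltW ab12) => /(_ isT) hR.
  have := ord_ge0_concaveL (t := ab.1) rf a0 ab12 bl hord.
  rewrite lexx (ltW ab12) => /(_ isT) hL.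
  have l0 : 0 < ab.2 - ab.1 by rewrite subr_gt0.
  (* By concavity on the segment, the slope at [v] is at least the mean slope towards the other end
     [w]; if that is positive, integrality makes the slope at least 1. *)
  have aux w (m : int) : w \in points d -> f w <= f v + m%:~R * (ab.2 - ab.1) ->
      (tau w < tau v)%R%:Z <= m.
    move=> wd hw; case: (hv w wd) => [h|[h1 h2]].
      have : 0 < m%:~R * (ab.2 - ab.1) by lra.
      rewrite pmulr_lgt0 // ltr0z => m0; apply: (@le_trans _ _ 1); last exact: m0.
      by case: (_ < _).
    rewrite ltNge h2 /=.
    have : 0 <= m%:~R * (ab.2 - ab.1) by lra.
    by rewrite pmulr_lge0 // ler0z.
  apply: lerD; case: eqP => //= E.
    by apply: aux => //; rewrite -E.
  by apply: aux => //; rewrite -E.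
have := hf v; rewrite coeff_moderator // vd /ord; move: key; clear.
by lia.
Qed.

(** * Chip firing of a set of points of a model *)

Section Fire.
Variables (d : edge G -> seq R) (U : pred (tpoint G)).
Hypothesis hd : is_model d.
Variable eps : R.
Hypothesis eps0 : 0 < eps.
Hypothesis epsP : forall e ab, ab \in segments d e -> eps <= ab.2 - ab.1.

(** Firing [U] through a distance [eps]: the function is [- eps] on segments with both ends in [U],
    climbs to 0 with slope 1 on segments leaving [U], and vanishes on the others because no segment
    is shorter than [eps]. *)
Definition fire_seg e (ab : R * R) t : R :=
  Num.min 0 ((~~ U (pt e ab.2))%:Z%:~R * (t - ab.1) +
             (~~ U (pt e ab.1))%:Z%:~R * (ab.2 - t) - eps).

Definition fire (x : tpoint G) : R :=
  match x with
  | inl v => if U (inl v) then - eps else 0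
  | inr y => let e := tag y in let t := val (tagged y) in
      fire_seg e (nth (0, 0) (segments d e) (find (fun cd => t <= cd.2) (segments d e))) t
  end.

Lemma fire_seg_left e ab : ab \in segments d e ->
  fire_seg e ab ab.1 = if U (pt e ab.1) then - eps else 0.
Proof.
move=> /epsP h; rewrite /fire_seg subrr mulr0 add0r.
case: (U (pt e ab.1)) => /=; rewrite ?mul0r ?mul1r ?sub0r.
  by rewrite min_r // oppr_le0 ltW.
by rewrite min_l // subr_ge0.
Qed.

Lemma fire_seg_right e ab : ab \in segments d e ->
  fire_seg e ab ab.2 = if U (pt e ab.2) then - eps else 0.
Proof.
move=> /epsP h; rewrite /fire_seg subrr mulr0 addr0.
case: (U (pt e ab.2)) => /=; rewrite ?mul0r ?mul1r ?sub0r.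
  by rewrite min_r // oppr_le0 ltW.
by rewrite min_l // subr_ge0.
Qed.

Lemma fire_pt e ab t : ab \in segments d e -> ab.1 <= t <= ab.2 ->
  fire (pt e t) = fire_seg e ab t.
Proof.
move=> hab /andP[at_ tb]; have [a0 ab12 bl _ _] := segmentsP hd hab.
have [t0|t0] := eqVneq t 0.
  have E : ab.1 = 0 by apply/le_anti; rewrite a0 -t0 at_.
  by rewrite t0 -{2}E fire_seg_left // E pt_src.
have [tl|tl] := eqVneq t (len e).
  have E : ab.2 = len e by apply/le_anti; rewrite bl -tl tb.
  by rewrite tl -{2}E fire_seg_right // E pt_tgt.
have ht : 0 < t < len e.
  by rewrite !lt_neqAle (eq_sym 0) t0 tl (le_trans a0) // (le_trans tb).
have -> : fire (pt e t) = fire_seg e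
    (nth (0, 0) (segments d e) (find (fun cd => t <= cd.2) (segments d e))) t.
  by have [u -> <-] := pt_innerE ht.
case: (ltgtP ab.1 t) at_ => // [at_ _|E _].
  by rewrite (@segs_find _ _ _ _ ab) // at_.
have td : t \in d e.
  have : ab.1 \in [seq ab.1 | ab <- segments d e] by apply: map_f.
  by rewrite map_segs_left E inE (negbTE t0).
have /mapP[ab' hab' E'] : t \in [seq ab.2 | ab <- segments d e].
  by rewrite map_segs_right mem_rcons inE td orbT.
have [_ ab12' _ _ _] := segmentsP hd hab'.
rewrite (@segs_find _ _ _ _ ab') ?E' ?ab12' ?lexx //.
by rewrite fire_seg_right // -E' -E fire_seg_left.
Qed.

Lemma fire_rational : rational_function fire.
Proof.
apply/rational_functionP => e; apply: int_pl_glue (hd e) _ => ab hab.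
pose m : int := (~~ U (pt e ab.2))%:Z - (~~ U (pt e ab.1))%:Z.
pose c : R := (~~ U (pt e ab.1))%:Z%:~R * ab.2 - (~~ U (pt e ab.2))%:Z%:~R * ab.1 - eps.
have E t : fire_seg e ab t = Num.min 0 (m%:~R * t + c).
  by rewrite /fire_seg /m /c rmorphB /=; congr Num.min; ring.
have line0 t : (0 : int)%:~R * t + 0 = 0 :> R by rewrite mul0r addr0.
apply: (@int_pl_min _ _ _ _ [:: (0, 0); (m, c)]) => [t ht|t mc ht].
  rewrite (fire_pt hab ht) E; have [h|h] := leP 0 (m%:~R * t + c).
    by exists (0, 0); [exact: mem_head | exact: esym (line0 t)].
  by exists (m, c); rewrite // !inE eqxx orbT.
rewrite (fire_pt hab ht) E !inE => /orP[]/eqP ->; last by rewrite ge_min lexx orbT.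
by change (Num.min 0 (m%:~R * t + c) <= (0 : int)%:~R * t + 0); rewrite line0 ge_min lexx.
Qed.

Lemma fire_le0 x : fire x <= 0.
Proof.
case: x => [v|y] /=; last by rewrite ge_min lexx.
by case: ifP => // _; rewrite oppr_le0 ltW.
Qed.

Lemma fire_points v : v \in points d -> fire v = if U v then - eps else 0.
Proof.
have [e [t [ht ->]]] := pt_surj v; have [ab hab hin] := segs_cover (hd e) ht.
have [_ _ _ _ hout] := segmentsP hd hab; case/andP: (hin) => h1 h2 vd.
rewrite (fire_pt hab hin).
case: (ltgtP ab.1 t) h1 => // [h1 _|<- _]; last exact: fire_seg_left.
case: (ltgtP t ab.2) h2 => // [h2 _|-> _]; last exact: fire_seg_right.
by have := hout t; rewrite h1 h2 vd => /(_ isT).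
Qed.

(** Only points of [U] lose chips. Points of the model outside [U] are maxima, and inside a segment
    the function is a minimum of two affine functions, hence concave. *)
Lemma ord_fire_ge0 p : ~~ ((p \in points d) && U p) -> 0 <= ord fire p.
Proof.
have [pd|pd] := boolP (p \in points d) => /= hp.
  apply: (ord_ge0_max fire_rational) => x.
  by rewrite (fire_points pd) (negbTE hp) fire_le0.
case: p pd {hp} => [v|[e u]]; first by rewrite inl_points.
rewrite -pt_inner => hp; have [ab hab hu] := seg_of_inner hd (valP u) hp.
have [a0 ab12 bl _ _] := segmentsP hd hab; set t := val u in hu *.
have hu' : ab.1 <= t <= ab.2 by case/andP: hu => /ltW -> /ltW ->.
have [h|h] := leP 0 (fire (pt e t)).
  by apply: (ord_ge0_max fire_rational) => x; apply: le_trans (fire_le0 x) h.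
pose m : int := (~~ U (pt e ab.2))%:Z - (~~ U (pt e ab.1))%:Z.
apply: (@ord_ge0_inner _ _ _ _ _ m fire_rational a0 bl hu) => w hw.
rewrite (fire_pt hab hw) (fire_pt hab hu'); rewrite (fire_pt hab hu') in h.
have {}h : fire_seg e ab t = (~~ U (pt e ab.2))%:Z%:~R * (t - ab.1) +
             (~~ U (pt e ab.1))%:Z%:~R * (ab.2 - t) - eps.
  by move: h; rewrite /fire_seg gt_min ltxx /= => h; rewrite min_r // ltW.
rewrite {}h /fire_seg ge_min; apply/orP; right.
by rewrite /m rmorphB /=; lra.
Qed.

(** A fired point sends at most one chip along each segment leaving [U]. *)
Lemma ord_fire p : p \in points d -> U p -> - nflags d (fun u => ~~ U u) p <= ord fire p.
Proof.
move=> pd Up; rewrite /ord lerN2 (sum_tangent (slope fire) hd pd).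
apply: ler_sum => e _; rewrite big_seq_cond [leRHS]big_seq_cond.
apply: ler_sum => ab /andP[hab _].
have [a0 ab12 bl _ _] := segmentsP hd hab.
have l0 : 0 < ab.2 - ab.1 by rewrite subr_gt0.
have hs t : fire_seg e ab t <= (~~ U (pt e ab.2))%:Z%:~R * (t - ab.1) +
             (~~ U (pt e ab.1))%:Z%:~R * (ab.2 - t) - eps.
  by rewrite /fire_seg ge_min lexx orbT.
apply: lerD; case: eqP => //= E.
  have st : starts (e, false) ab.1 by rewrite /starts /= a0 (lt_le_trans ab12).
  apply: (slope_le fire_rational (starts_pt st).1 l0) => t /andP[t0 tl].
  rewrite (ray_pt t st) /= (fire_pt hab); last by apply/andP; split; lra.
  rewrite (fire_pt hab) ?lexx ?(ltW ab12) // (fire_seg_left hab) E Up.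
  apply: le_trans (hs _) _; rewrite E Up /=; lra.
have st : starts (e, true) ab.2 by rewrite /starts /= bl (le_lt_trans a0).
apply: (slope_le fire_rational (starts_pt st).1 l0) => t /andP[t0 tl].
rewrite (ray_pt t st) /= (fire_pt hab); last by apply/andP; split; lra.
rewrite (fire_pt hab) ?lexx ?(ltW ab12) // (fire_seg_right hab) E Up.
by apply: le_trans (hs _) _; rewrite E Up /=; lra.
Qed.

End Fire.

Lemma fire_exists d U : is_model d -> exists h, [/\ rational_function h,
  forall x, h x <= 0,
  forall v, v \in points d -> if U v then h v < 0 else h v == 0,
  forall v, v \in points d -> U v -> - nflags d (fun u => ~~ U u) v <= ord h v &
  forall v, ~~ ((v \in points d) && U v) -> 0 <= ord h v].
Proof.
move=> hd.
have [|eps eps0 heps] := @pos_lower_bound R _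
    [seq ab.2 - ab.1 | e <- enum (edge G), ab <- segments d e] id.
  move=> x /allpairsPdep[e [ab [_ hab ->]]]; have [_ h _ _ _] := segmentsP hd hab.
  by rewrite subr_gt0.
have epsP e ab : ab \in segments d e -> eps <= ab.2 - ab.1.
  by move=> hab; apply: heps; apply/allpairsPdep; exists e, ab; rewrite mem_enum.
exists (fire d U eps); split.
- exact: fire_rational.
- exact: fire_le0.
- move=> v vd; rewrite (fire_points U hd eps0 epsP vd).
  by case: (U v); rewrite ?oppr_lt0 ?eqxx.
- exact: ord_fire.
- exact: ord_fire_ge0.
Qed.

(** Coinciding ends could only come from a segment that is an entire loop, and such a segment
    contains the midpoint of its edge. *)
Lemma segment_ends_neq d e ab : is_model d -> ab \in segments d e ->
  ~~ (ab.1 < len e / 2 < ab.2) -> pt e ab.1 != pt e ab.2.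
Proof.
move=> hd hab hmid; have [a0 ab12 bl _ _] := segmentsP hd hab.
have l0 := len_gt0 e; apply/eqP => E.
have [ha|ha] := boolP (0 < ab.1 < len e); last first.
  have Ea : ab.1 = 0.
    apply/le_anti; rewrite a0 andbT leNgt; apply/negP => h; move: ha.
    by rewrite h (lt_le_trans ab12).
  have [hb|hb] := boolP (0 < ab.2 < len e).
    by move: E; rewrite Ea pt_src; have [u -> _] := pt_innerE hb.
  have Eb : ab.2 = len e.
    apply/le_anti; rewrite bl leNgt; apply/negP => h; move: hb.
    by rewrite h (le_lt_trans a0).
  by move: hmid; rewrite Ea Eb; lra.
have [hb|hb] := boolP (0 < ab.2 < len e).
  by have [_ h] := pt_inj_inner ha hb E; move: ab12; rewrite h ltxx.
by move: E; rewrite (ptE hb); have [u -> _] := pt_innerE ha.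
Qed.

Lemma index_separates d (s : seq (tpoint G)) : is_model d ->
  (forall e ab, ab \in segments d e -> ~~ (ab.1 < len e / 2 < ab.2)) ->
  {subset points d <= s} -> separates d (fun u => (index u s)%:Z).
Proof.
move=> hd hmid ds e ab hab; have [_ _ _ [m1 m2] _] := segmentsP hd hab.
rewrite eqz_nat; apply/negP => /eqP E.
have /eqP[] := segment_ends_neq hd hab (hmid _ _ hab).
by rewrite -(nth_index (pt e ab.1) (ds _ m1)) E nth_index // ds.
Qed.

(* Dhar's burning algorithm, run from q on the divisor D - q + div f where f is
   the least function: a set of points that cannot be burnt could be fired, and
   f would not be the least. *)
Lemma burning D q : effective D -> ~ eff_equiv (D - << q >>) ->
  exists d tau D1, [/\ is_model d, separates d tau, lin_equiv (D - << q >>) D1 &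
    forall p, coeff p D1 <= coeff p (moderator d tau)].
Proof.
move=> eD hno; have nf := least_functionP q eD.
set f := least_function D q in nf; have [rf fq f0 hf] := nf.
have [P _ hP] := principalP rf; pose D1 := D - << q >> + P.
have hD1 x : coeff x D1 = coeff x D + ord f x - (x == q)%:R.
  by rewrite !coeffD coeffN hP coeffU mul1r (eq_sym q); ring.
have eqD1 : lin_equiv (D - << q >>) D1.
  exists (fun x => - f x) => [|x]; first exact: rational_functionN.
  by rewrite ordN // -hP !coeffB !coeffD; ring.
(* All other coefficients of [D1] are nonnegative, so a coefficient at least 0 at [q] would make
   [D1] effective. *)
have D1q : coeff q D1 = -1.
  apply/le_anti/andP; split; last first.
    by rewrite hD1 eqxx -subr_ge0 opprK subrK.
  rewrite leNgt; apply/negP => h; apply: hno; exists D1 => // x.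
  have [->|xq] := eqVneq x q; first by move: h; clear; lia.
  by rewrite hD1 (negbTE xq) subr0.
have [d [hd hT hmid]] := model_exists (fun e => [:: len e / 2]) (q :: dom D1).
have qd : q \in points d by apply: hT; rewrite inE eqxx.
(* [s] lists the burnt points in order of burning. A point has burnt if it has fewer chips than
   segments to points burnt before it; [q], with -1 chips, burns unaided. *)
pose burnt (s : seq (tpoint G)) := [/\ uniq s, {subset s <= points d}, q \in s &
  forall v, v \in s -> coeff v D1 <= nflags d (fun u => index u s < index v s)%N v - 1].
have step s : burnt s -> ~ {subset points d <= s} ->
    exists2 v, v \in points d & v \notin s /\ burnt (rcons s v).
  move=> [us sd qs hs] hsub.
  have [v vd [vs hv]] : exists2 v, v \in points d &
      v \notin s /\ coeff v D1 < nflags d (fun u => u \in s) v.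
    apply: contrapT => hnone.
    (* If nothing more burns, every unburnt point has enough chips to be fired. Firing them all
       leaves D + div nonnegative and fixes the value at [q], but lowers f at the unburnt points. *)
    have [h [rh h0 hp hU hnU]] := fire_exists (fun u => u \notin s) hd.
    have nfh : normalized D q (fun x => f x + h x).
      split=> [||x|x]; first exact: rational_functionD.
      - by have := hp q qd; rewrite qs /= fq => /eqP ->; rewrite addr0.
      - by rewrite -(addr0 0) lerD.
      rewrite ordD // addrA; have [/andP[xd xs]|xs] := boolP ((x \in points d) && (x \notin s)).
        have hx : nflags d (fun u => u \in s) x <= coeff x D1.
          by rewrite leNgt; apply/negP => hlt; apply: hnone; exists x.
        have := hU x xd xs; rewrite (_ : (fun u => ~~ _) = fun u => u \in s); last first.
          by apply/funext => u /=; rewrite negbK.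
        have xq : x != q by apply: contra xs => /eqP ->.
        move: hx; rewrite hD1 (negbTE xq) subr0 => h1 h2.
        by apply: le_trans (lerD h1 h2); rewrite subrr.
      by rewrite addr_ge0 // hnU.
    apply: hsub => v vd; apply: contrapT => /negP vs.
    have := least_function_le eD v nfh; rewrite -/f.
    by have := hp v vd; rewrite vs; lra.
  exists v => //; split=> //; split.
  - by rewrite rcons_uniq vs.
  - by move=> u; rewrite mem_rcons inE => /orP[/eqP ->|/sd].
  - by rewrite mem_rcons inE qs orbT.
  move=> u; rewrite mem_rcons inE => /orP[/eqP ->|us'].
    rewrite lerBrDr lezD1; apply: lt_le_trans hv _; apply: nflags_le => w ws.
    by rewrite -cats1 !index_cat ws (negbTE vs) /= eqxx addn0 index_mem.
  apply: le_trans (hs u us') _; rewrite lerD2r; apply: nflags_le => w.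
  rewrite -cats1 !index_cat us'; case: ifP => // ws.
  by rewrite memNindex ?ws // ltnNge index_size.
have burnt_q : burnt [:: q].
  split=> //; first by move=> u; rewrite inE => /eqP ->.
  - by rewrite inE.
  move=> v; rewrite inE => /eqP ->; rewrite D1q lerBrDr addNr.
  exact: nflags_ge0.
have [s [us sd qs hs] ds] : exists2 s, burnt s & {subset points d <= s}.
  suff : forall n s, burnt s -> (size (points d) - size s <= n)%N ->
      exists2 s, burnt s & {subset points d <= s}.
    by apply; [exact: burnt_q | exact: leqnn].
  elim=> [|n IH] s bs hn.
    exists s => //; have [us sd _ _] := bs.
    by move=> u; rewrite (uniq_min_size us sd) // -subn_eq0 -leqn0.
  have [h|h] := pselect {subset points d <= s}; first by exists s.
  have [v vd [vs bs']] := step s bs h; apply: IH bs' _.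
  by rewrite size_rcons subnS -subn1 leq_subLR add1n.
exists d, (fun u => (index u s)%:Z), D1; split=> //.
  by apply: index_separates => // e ab hab; apply: (hmid _ _ hab); exact: mem_head.
move=> p; rewrite coeff_moderator //; case: ifPn => pd.
  by apply: le_trans (hs p (ds p pd)) _; rewrite lerD2r; apply: nflags_le.
by rewrite coeff_outdom //; apply: contra pd => pD; apply: hT; rewrite inE pD orbT.
Qed.

End Burning.

(** * Riemann-Roch inequalities and gaps *)

Section RiemannRoch.
Context {R : realType} {G : tropicalCurve R}.
Implicit Types (p q : tpoint G) (D E F : divisor G) (s : seq (tpoint G)) (k m n : nat).

(** By connectedness the kernel of the transposed boundary matrix consists of the constants, so the
    boundary has rank #|V| - 1. *)
Lemma genusE : (genus G)%:Z = #|edge G|%:Z - #|vertex G|%:Z + 1.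
Proof.
pose B := boundary G; pose c : 'rV[R]_#|vertex G| := const_mx 1.
have mulB (u : 'rV[R]_#|vertex G|) i : (u *m B^T) 0 i =
    u 0 (enum_rank (tgt (enum_val i))) - u 0 (enum_rank (src (enum_val i))).
  rewrite mxE; under eq_bigr do rewrite !mxE mulrBr.
  rewrite sumrB; congr (_ - _).
    rewrite (bigD1 (enum_rank (tgt (enum_val i)))) //= enum_rankK eqxx mulr1 big1 ?addr0 //.
    move=> j jne; case: eqP => [E|_]; last by rewrite mulr0.
    by rewrite E enum_valK eqxx in jne.
  rewrite (bigD1 (enum_rank (src (enum_val i)))) //= enum_rankK eqxx mulr1 big1 ?addr0 //.
  move=> j jne; case: eqP => [E|_]; last by rewrite mulr0.
  by rewrite E enum_valK eqxx in jne.
have /card_gt0P[v0 _] := vertex_gt0 G.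
have eqker : (kermx B^T :=: c)%MS.
  apply/eqmxP/andP; split; last first.
    by apply/sub_kermxP/matrixP => i j; rewrite ord1 mulB !mxE subrr.
  apply/rV_subP => u /sub_kermxP uB.
  have edge_eq e : u 0 (enum_rank (tgt e)) = u 0 (enum_rank (src e)).
    have := mulB u (enum_rank e); rewrite uB mxE enum_rankK => /esym/eqP.
    by rewrite subr_eq0 => /eqP.
  have const v : u 0 (enum_rank v) = u 0 (enum_rank v0).
    have /connectP[s hs ->] := connected v0 v.
    elim: s v0 hs => //= w s IH x /andP[/existsP[e he] hs]; rewrite (IH w hs).
    by case/orP: he => /andP[/eqP <- /eqP <-]; rewrite edge_eq.
  rewrite (_ : u = u 0 (enum_rank v0) *: c) ?scalemx_sub //.
  by apply/matrixP => i j; rewrite ord1 !mxE mulr1 -(const (enum_val j)) enum_valK.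
have c0 : c != 0.
  by apply/eqP => /matrixP/(_ 0 (enum_rank v0)); rewrite !mxE => /eqP; rewrite oner_eq0.
have rB := mxrank_ker B^T; rewrite eqker rank_rV c0 mxrank_tr in rB.
have := mxrank_ker B; rewrite -/(genus G) => ->.
have := rank_leq_row B; have := rank_leq_col B; move: rB; lia.
Qed.

Lemma effective_deg_le D E : (forall p, coeff p D <= coeff p E) -> deg D <= deg E.
Proof.
move=> h; rewrite -subr_ge0 -degB; apply: deg_effective => p.
by rewrite coeffB subr_ge0.
Qed.

(** Otherwise [D - << q >>], of degree at least g, would be equivalent to a divisor bounded by a
    moderator, of degree g - 1. *)
Lemma eff_equiv_sub1 D q : effective D -> (genus G)%:Z < deg D ->
  eff_equiv (D - << q >>).
Proof.
move=> eD hdeg; apply: contrapT => /(burning eD)[d [tau [D1 [hd hsep h1 h2]]]].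
have := effective_deg_le h2; rewrite (deg_moderator hd hsep) -(lin_equiv_deg h1).
by rewrite degB degU; have := genusE; move: hdeg; lia.
Qed.

Lemma eff_equiv_sub D s : effective D -> (genus G)%:Z + (size s)%:Z <= deg D ->
  eff_equiv (D - \sum_(p <- s) << p >>).
Proof.
elim: s D => [|q s IH] D eD hdeg.
  by rewrite big_nil subr0; exists D => //; exact: lin_equiv_refl.
have [|E eE hE] := @eff_equiv_sub1 D q eD; first by move: hdeg => /=; lia.
have := lin_equiv_deg hE; rewrite degB degU => dE.
rewrite big_cons opprD addrA.
apply: eff_equiv_lin (lin_equiv_addr (- \sum_(p <- s) << p >>) hE) _.
by apply: IH eE _; move: hdeg dE => /=; lia.
Qed.

Lemma divisor_split D : exists E s, effective E /\ D = E - \sum_(p <- s) << p >>.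
Proof.
elim/freeg_ind_dom0: D => [|k p D _ _ [E [s [eE ->]]]].
  by exists 0, [::]; split; [move=> x; rewrite coeff0 | rewrite big_nil subr0].
have [k0|k0] := leP 0 k.
  exists (<< k *g p >> + E), s; split; last by rewrite addrA.
  by apply: effectiveD eE; apply: effectiveU.
exists E, (nseq `|k| p ++ s); split=> //; rewrite big_cat big_nseq /= opprD addrCA.
congr (_ + (_ - _)); rewrite -Monoid.iteropE.
have -> : iterop `|k| +%R << p >> 0 = << p >> *+ `|k| :> divisor G by [].
by rewrite freegU_muln freegUN; congr (<< _ *g _ >>); lia.
Qed.

(** Write [D] as an effective divisor minus some points and subtract these one by one: before each
    subtraction the degree still exceeds g. *)
Lemma eff_equiv_deg_ge D : (genus G)%:Z <= deg D -> eff_equiv D.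
Proof.
have [E [s [eE ->]]] := divisor_split D; rewrite degB raddf_sum /=.
under eq_bigr do rewrite degU.
by rewrite sum1_seqz => h; apply: eff_equiv_sub => //; move: h; lia.
Qed.

Lemma deg_sum_points s : deg (\sum_(p <- s) << p >> : divisor G) = (size s)%:Z.
Proof. by rewrite raddf_sum /=; under eq_bigr do rewrite degU; exact: sum1_seqz. Qed.

Lemma riemann_rank_ge D k : (genus G)%:Z + k%:Z <= deg D -> rank_ge D k.
Proof.
move=> h s; apply: eff_equiv_deg_ge.
by rewrite degB deg_sum_points size_tuple; move: h; lia.
Qed.

Lemma deg_canonical : deg (canonical G) = 2 * (genus G)%:Z - 2.
Proof.
have [d [hd _ hmid]] := @model_exists R G (fun e => [:: len e / 2]) [::].
pose tau (u : tpoint G) := (index u (points d))%:Z.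
have hsep : separates d tau.
  by apply: index_separates => // e ab hab; apply: (hmid _ _ hab); exact: mem_head.
have hsep' : separates d (fun u => - tau u).
  by move=> e ab hab; rewrite eqr_opp; exact: hsep.
rewrite (canonical_moderator hd hsep) degD !deg_moderator //.
by have := genusE; lia.
Qed.

Lemma canonical_rank_ge : (1 < genus G)%N -> rank_ge (canonical G) (genus G).-1.
Proof.
move=> g1 s; case: s => -[|q s] /= /eqP hs; first by move: hs g1; clear; lia.
(* One point [q] of the g - 1 is set apart: [F], the canonical divisor minus the other g - 2, has
   degree exactly g and is therefore equivalent to an effective divisor. *)
rewrite big_cons opprD addrCA addrC; set F := _ + - \sum_(p <- s) _.
have dF : deg F = (genus G)%:Z.
  by rewrite degB deg_sum_points deg_canonical; move: hs => /=; lia.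
have [E eE hE] : eff_equiv F by apply: eff_equiv_deg_ge; rewrite dF.
rewrite -/(eff_equiv _); apply: contrapT => hno.
have hEq : ~ eff_equiv (E - << q >>).
  by move=> h; apply: hno; apply: eff_equiv_lin h; apply: lin_equiv_addr.
have [d [tau [D1 [hd hsep h1 h2]]]] := burning eE hEq.
(* [D1] is bounded by the moderator and both have degree g - 1. *)
have E1 : D1 = moderator d tau.
  apply/esym/eqP; rewrite -subr_eq0; apply/eqP/fgpos_eq0P.
    by apply/fgposP => p; rewrite coeffB subr_ge0.
  rewrite degB (deg_moderator hd hsep) -(lin_equiv_deg h1) degB degU.
  by rewrite -(lin_equiv_deg hE) dF; have := genusE; lia.
have hM : lin_equiv (F - << q >>) (moderator d tau).
  by rewrite -E1; apply: lin_equiv_trans h1; apply: lin_equiv_addr.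
(* With S the sum over [s], K - S - q is equivalent to the moderator M. As K = M + M', the opposite
   moderator M' is equivalent to the effective divisor q + S. *)
apply: (@moderator_not_eff _ _ d (fun u => - tau u) hd).
exists (<< q >> + \sum_(p <- s) << p >>).
  apply: effectiveD; first exact: effectiveU.
  elim: (s) => [|x s' IH]; first by move=> p; rewrite big_nil coeff0.
  by rewrite big_cons; apply: effectiveD IH; apply: effectiveU.
have := lin_equiv_addr (<< q >> + \sum_(p <- s) << p >> - moderator d tau) hM.
rewrite /F (canonical_moderator hd hsep).
set S := \sum_(p <- s) _; set M := moderator d tau; set M' := moderator d _.
have -> : M + M' - S - << q >> + (<< q >> + S - M) = M'.
  by apply: divisorP => x; rewrite !(coeffD, coeffN); ring.
have -> // : M + (<< q >> + S - M) = << q >> + S.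
by apply: divisorP => x; rewrite !(coeffD, coeffN); ring.
Qed.

End RiemannRoch.

(** * Elementary properties of the rank, and the shape of gap sequences *)

Section Rank.
Context {R : realType} {G : tropicalCurve R}.
Implicit Types (p q : tpoint G) (D E F : divisor G) (s : seq (tpoint G)) (k m n : nat).

Lemma rank_ge0E D : rank_ge D 0 <-> eff_equiv D.
Proof.
split=> [h|h s]; last by rewrite (tuple0 s) big_nil subr0.
by have := h [tuple]; rewrite big_nil subr0.
Qed.

Lemma rank_ge_sub D p k : rank_ge D k.+1 -> rank_ge (D - << p >>) k.
Proof. by move=> h s; have := h (cons_tuple p s); rewrite big_cons opprD addrA. Qed.

Lemma rank_ge_of_sub D p k : rank_ge (D - << p >>) k -> rank_ge D k.
Proof.
move=> h s; rewrite -/(eff_equiv _).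
have -> : D - \sum_(x <- s) << x >> = D - << p >> - \sum_(x <- s) << x >> + << p >>.
  by apply: divisorP => y; rewrite !(coeffD, coeffN); ring.
by apply: eff_equivD; [exact: h | exact: effectiveU].
Qed.

Lemma rank_ge_le D k n : (k <= n)%N -> rank_ge D n -> rank_ge D k.
Proof.
have /card_gt0P[v0 _] := vertex_gt0 G.
move=> /subnK <-; elim: (n - k)%N => // i IH h; apply: IH.
exact: rank_ge_of_sub (rank_ge_sub (inl v0) h).
Qed.

Lemma rank_ge_lin D E k : lin_equiv D E -> rank_ge D k -> rank_ge E k.
Proof.
move=> /lin_equiv_sym h hD s; apply: eff_equiv_lin (hD s).
exact: lin_equiv_addr.
Qed.

Lemma rank_ge_deg D k : rank_ge D k -> k%:Z <= deg D.
Proof.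
have /card_gt0P[v0 _] := vertex_gt0 G.
move=> /(_ (nseq_tuple k (inl v0))) /deg_eff_equiv.
by rewrite degB deg_sum_points size_nseq subr_ge0.
Qed.

Lemma rank_spec D : (rank_set D `&` ubound (rank_set D)) (rank D).
Proof.
apply: xgetPex; have [h0|h0] := pselect (rank_ge D 0); last first.
  exists (-1); split; first by left.
  move=> _ [->//|[k hk <-]]; case: h0; exact: rank_ge_le hk.
have ex : exists k, `[< rank_ge D k >] by exists 0; apply/asboolP.
have bd k : `[< rank_ge D k >] -> (k <= `|deg D|)%N.
  by move=> /asboolP/rank_ge_deg; lia.
case: (ex_maxnP ex bd) => k /asboolP hk hmax.
exists k%:Z; split; first by right; exists k.
by move=> _ [->//|[n hn <-]]; rewrite lez_nat; apply: hmax; apply/asboolP.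
Qed.

Lemma rank_geP D k : k%:Z <= rank D <-> rank_ge D k.
Proof.
have [h1 h2] := rank_spec D; split=> [|hk]; last by apply: h2; right; exists k.
by case: h1 => [->|[n hn <-]] //; rewrite lez_nat => /rank_ge_le; apply.
Qed.

Lemma rank_geN1 D : -1 <= rank D.
Proof. by have [_] := rank_spec D; apply; left. Qed.

Lemma rank_le D E : (forall k, rank_ge D k -> rank_ge E k) -> rank D <= rank E.
Proof.
move=> h; have := rank_geN1 D; case E0 : (rank D) => [k|[|k]] // _.
  by apply/rank_geP/h/rank_geP; rewrite E0.
exact: rank_geN1.
Qed.

Lemma rank_lin D E : lin_equiv D E -> rank D = rank E.
Proof.
move=> h; apply/le_anti/andP; split; apply: rank_le => k; apply: rank_ge_lin => //.
exact: lin_equiv_sym.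
Qed.

Lemma rank_sub_le D p : rank (D - << p >>) <= rank D.
Proof. by apply: rank_le => k; exact: rank_ge_of_sub. Qed.

Lemma rank_sub_ge D p : rank D - 1 <= rank (D - << p >>).
Proof.
have := rank_geN1 D; case E : (rank D) => [[|k]|[|k]] // _.
- exact: rank_geN1.
- have -> : (k.+1%:Z - 1 = k%:Z) by lia.
  by apply/rank_geP/rank_ge_sub/rank_geP; rewrite E.
- by apply: le_trans (rank_geN1 _).
Qed.

Lemma rank_subn_ge D p (m : nat) : rank D - m%:Z <= rank (D - << m%:Z *g p >>).
Proof.
elim: m => [|m IH]; first by rewrite freegU0 !subr0.
have -> : D - << m.+1%:Z *g p >> = D - << m%:Z *g p >> - << p >>.
  by rewrite -addn1 PoszD -freegUD opprD addrA.
have := rank_sub_ge (D - << m%:Z *g p >>) p; move: IH; rewrite -addn1 PoszD; lia.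
Qed.

Lemma rank_le_deg D k : k%:Z <= rank D -> k%:Z <= deg D.
Proof. by move=> /rank_geP/rank_ge_deg. Qed.

(* The gaps are 1, ..., r and N. *)
Lemma weightE D p (r : nat) : rank D = r%:Z -> rank (D - << r%:Z *g p >>) <= 0 ->
  exists N : nat, [/\ weight D p = N%:Z - r%:Z - 1,
    0 <= rank (D - << N%:Z - 1 *g p >>) & rank (D - << N%:Z *g p >>) < 0].
Proof.
move=> rD hr; pose rho m := rank (D - << m%:Z *g p >>).
have rho0 : rho 0 = r%:Z by rewrite /rho freegU0 subr0.
have rhoE m : D - << m.+1%:Z *g p >> = D - << m%:Z *g p >> - << p >>.
  by rewrite -addn1 PoszD -freegUD opprD addrA.
have rhoS m : rho m.+1 <= rho m by rewrite /rho rhoE rank_sub_le.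
have rhoB m : rho m - 1 <= rho m.+1 by rewrite /rho rhoE rank_sub_ge.
have rho_le m n : (m <= n)%N -> rho n <= rho m.
  by move=> /subnK <-; elim: (n - m)%N => // i IH; exact: le_trans (rhoS _) IH.
have rho_ge m n : (m <= n)%N -> rho m - (n - m)%:Z <= rho n.
  move=> mn; rewrite -{2}(subnKC mn); elim: (n - m)%N => [|i IH].
    by rewrite addn0 subr0.
  by rewrite addnS; have := rhoB (m + i)%N; move: IH; lia.
have rho_r m : (m <= r)%N -> rho m = r%:Z - m%:Z.
  move=> mr; have := rho_ge 0 m (leq0n _); have := rho_ge m r mr.
  by rewrite rho0; move: hr; rewrite -/(rho r); lia.
have ex : exists m, rho m < 0.
  exists `|deg D|.+1; rewrite ltNge; apply/negP => /(@rank_le_deg _ 0).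
  by rewrite degB degU; lia.
case: (ex_minnP ex) => N hN hmin.
have rN : (r < N)%N.
  rewrite ltnNge; apply/negP => h; have := rho_r _ h; move: h hN; clear; lia.
have hgap m : gap_set D p m <-> (m \in rcons (iota 1 r) N).
  rewrite mem_rcons inE mem_iota add1n ltnS /gap_set /=.
  case: m => [|m] /=; first by split => // /orP[/eqP E|//]; move: rN; rewrite -E.
  rewrite (_ : m.+1%:Z - 1 = m%:Z) -/(rho m) -/(rho m.+1); last by lia.
  have [mr|mr] := ltnP m r.
    by rewrite orbT (rho_r m) 1?ltnW // (rho_r m.+1) //; split=> // _; lia.
  rewrite orbF; have := rho_le r m mr; rewrite (rho_r r) // subrr => rm0.
  have [mN|mN|mN] := ltngtP m.+1 N.
  - have h x : (x < N)%N -> 0 <= rho x by rewrite leNgt => xN; apply/negP => /hmin; rewrite leqNgt xN.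
    by have h1 := h _ mN; split=> // h'; move: rm0 h' h1; clear; lia.
  - have := rho_le N m; rewrite -ltnS mN => /(_ isT) h.
    by have := rank_geN1 (D - << m.+1%:Z *g p >>); rewrite -/(rho _); split=> // h'; lia.
  - split=> // _; rewrite mN; apply: (lt_le_trans hN); rewrite leNgt; apply/negP => /hmin.
    by rewrite -mN ltnn.
have fin : finite_set (gap_set D p).
  by apply: sub_finite_set (finite_seq (rcons (iota 1 r) N)) => m /hgap.
have gapE : gap_seq D p = rcons (iota 1 r) N.
  apply: (@sorted_eq _ leq leq_trans anti_leq).
  - exact: sort_sorted leq_total _.
  - rewrite (sorted_pairwise leq_trans) pairwise_rcons -(sorted_pairwise leq_trans).
    rewrite iota_sorted andbT; apply/allP => m; rewrite mem_iota add1n ltnS.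
    by case/andP=> _ mr; rewrite ltnW // (leq_ltn_trans mr).
  rewrite perm_sort; apply: uniq_perm; first exact: fset_uniq.
    by rewrite rcons_uniq iota_uniq mem_iota add1n ltnS (leqNgt N) rN andbF.
  move=> m; rewrite in_fset_set //; apply/idP/idP => [|hm].
    by rewrite inE => /hgap.
  by rewrite inE; apply/hgap.
exists N; split=> //.
  rewrite /weight gapE size_rcons size_iota big_ord_recr /= nth_rcons size_iota ltnn eqxx.
  rewrite big1 => [|i _]; first by lia.
  by rewrite nth_rcons size_iota ltn_ord nth_iota // add1n subrr.
have -> : N%:Z - 1 = N.-1%:Z by move: rN; clear; lia.
rewrite leNgt -/(rho _); apply/negP => /hmin; move: rN; clear; lia.
Qed.

End Rank.

(** * Tents *)

Section Isolated.
Context {R : realType} {G : tropicalCurve R}.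
Implicit Types (p q x : tpoint G) (D E F : divisor G) (e : edge G) (a b c t : R).

Lemma nbhs_pdistP p (V : set (tpoint G)) :
  nbhs p V <-> exists2 eps, 0 < eps & forall q, pdist p q < eps -> V q.
Proof.
split=> [/nbhs_ballP[eps /= eps0 h]|[eps eps0 h]].
  by exists eps => // q hq; apply: h; rewrite ballEmdist.
by apply/nbhs_ballP; exists eps => //= q; rewrite ballEmdist => /h.
Qed.

Lemma isolatedP (A : set (tpoint G)) p : isolated A p <->
  A p /\ exists2 eps, 0 < eps & forall q, pdist p q < eps -> A q -> q = p.
Proof.
split=> [[/set_mem Ap [V /nbhs_pdistP[eps eps0 hV] E]]|[Ap [eps eps0 h]]].
  split=> //; exists eps => // q /hV Vq Aq.
  by have : (V `&` A) q by []; rewrite E.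
split; first exact: mem_set.
exists [set q | pdist p q < eps]; first by apply/nbhs_pdistP; exists eps.
by apply/seteqP; split=> [q [/= hq Aq]|_ ->]; [exact: h | split=> //=; rewrite pdistxx].
Qed.

Lemma slope_le_pt (f : tpoint G -> R) (h : edge G * bool) t (m : int) (r : R) :
  rational_function f -> starts h t -> 0 < r ->
  (forall s, 0 < s < r -> let t' := if h.2 then t - s else t + s in
     0 <= t' <= len h.1 -> f (pt h.1 t') <= f (pt h.1 t) + m%:~R * s) ->
  slope f (pt h.1 t) h <= m.
Proof.
move=> rf hs r0 hr; pose l := if h.2 then t else len h.1 - t.
have l0 : 0 < l.
  by move: hs; rewrite /l /starts; case: h.2 => /andP[h1 h2] //; rewrite subr_gt0.
apply: (slope_le rf (starts_pt hs).1 (r := Num.min r l)); first by rewrite lt_min r0.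
move=> s; rewrite lt_min => /and3P[s0 sr sl]; rewrite (ray_pt s hs); apply: hr.
  by rewrite s0.
move: hs sl; rewrite /starts /l; case: h.2 => /andP[h1 h2] sl; apply/andP; split; lra.
Qed.

Section Tent.
Variables (e : edge G) (a c b : R) (i j : nat).
Hypotheses (a0 : 0 <= a) (ac : a < c) (cb : c < b) (bl : b <= len e).
Hypothesis balanced : i%:R * (c - a) = j%:R * (b - c).

Definition tent t : R := Num.max 0 (Num.min (i%:R * (t - a)) (j%:R * (b - t))).

Definition tent_fun (x : tpoint G) : R :=
  if x is inr y then (if tag y == e then tent (val (tagged y)) else 0) else 0.

Lemma tent_left t : t <= c -> tent t = Num.max 0 (i%:R * (t - a)).
Proof.
move=> tc; rewrite /tent min_l //.
have : 0 <= (i%:R + j%:R) * (c - t) :> R by rewrite -natrD mulr_ge0 // subr_ge0.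
by move: balanced; lra.
Qed.

Lemma tent_right t : c <= t -> tent t = Num.max 0 (j%:R * (b - t)).
Proof.
move=> tc; rewrite /tent min_r //.
have : 0 <= (i%:R + j%:R) * (t - c) :> R by rewrite -natrD mulr_ge0 // subr_ge0.
by move: balanced; lra.
Qed.

Lemma tent_le_a t : t <= a -> tent t = 0.
Proof.
by move=> ta; rewrite tent_left ?(le_trans ta) ?ltW // max_l // mulr_ge0_le0 // subr_le0.
Qed.

Lemma tent_ge_b t : b <= t -> tent t = 0.
Proof.
by move=> ta; rewrite tent_right ?(le_trans _ ta) ?(ltW cb) // max_l // mulr_ge0_le0 // subr_le0.
Qed.

Lemma tent_ac t : a <= t <= c -> tent t = i%:R * (t - a).
Proof. by case/andP=> at_ tc; rewrite tent_left // max_r // mulr_ge0 // subr_ge0. Qed.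

Lemma tent_cb t : c <= t <= b -> tent t = j%:R * (b - t).
Proof. by case/andP=> at_ tc; rewrite tent_right // max_r // mulr_ge0 // subr_ge0. Qed.

Lemma tent_fun_pt e' t : 0 <= t <= len e' ->
  tent_fun (pt e' t) = if e' == e then tent t else 0.
Proof.
case/andP=> t0 tl; have [ht|ht] := boolP (0 < t < len e').
  by have [u -> <-] := pt_innerE ht.
rewrite (ptE ht) /=; case: eqP => // E; move: tl ht; rewrite E => tl.
rewrite negb_and -!leNgt => /orP[h|h]; last by rewrite tent_ge_b // (le_trans bl).
by rewrite tent_le_a // (le_trans h).
Qed.

Lemma tent_fun_rational : rational_function tent_fun.
Proof.
apply/rational_functionP => e'; have [->|ne] := eqVneq e' e; last first.
  apply: int_affine_pl; exists 0, 0 => t ht.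
  by rewrite tent_fun_pt // (negbTE ne) mul0r addr0.
apply: (@int_pl_sub _ tent); first by move=> t ht; rewrite tent_fun_pt // eqxx.
exists [:: a; c; b] => x y x0 xy yl hz.
have ha := hz a; have hc := hz c; have hb := hz b.
rewrite !inE !eqxx ?orbT /= in ha hc hb.
have {}ha := ha isT; have {}hc := hc isT; have {}hb := hb isT.
have [ya|ay] := leP y a.
  exists 0, 0 => t /andP[xt ty]; rewrite mul0r addr0 tent_le_a //; exact: le_trans ya.
have {}ha : a <= x by move: ha; rewrite ay andbT -leNgt.
have [yc|cy] := leP y c.
  exists i%:Z, (- (i%:R * a)) => t /andP[xt ty].
  rewrite tent_ac ?(le_trans ha) ?(le_trans ty) //.
  by rewrite -pmulrn; ring.
have {}hc : c <= x by move: hc; rewrite cy andbT -leNgt.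
have [yb|bY] := leP y b.
  exists (- j%:Z), (j%:R * b) => t /andP[xt ty].
  rewrite tent_cb ?(le_trans hc) ?(le_trans ty) //.
  by rewrite rmorphN /= -pmulrn; ring.
have {}hb : b <= x by move: hb; rewrite bY andbT -leNgt.
by exists 0, 0 => t /andP[xt ty]; rewrite mul0r addr0 tent_ge_b // (le_trans hb).
Qed.

(** Upper bounds are enough for [tent_equiv]. Both summands are kept because the two feet may be the
    same point of a loop. *)
Lemma slope_tent_fun p h : h \in tangent p ->
  (forall t, a < t < b -> p != pt e t) ->
  slope tent_fun p h <= (if (h == (e, false)) && (p == pt e a) then i%:Z else 0) +
                        (if (h == (e, true)) && (p == pt e b) then j%:Z else 0).
Proof.
move=> hp hout; have [hs ep] := tangentP hp; move: (coord p h) hs ep => t hs ep.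
subst p; have rt := tent_fun_rational.
case: h hp hs hout => e' d /= hp hs hout; rewrite !xpair_eqE.
have ht : 0 <= t <= len e'.
  by case: d {hp} hs; rewrite /starts /= => /andP[h1 h2]; rewrite ?h1 ?h2 ?(ltW h1) ?ltW.
have [Ee|ne] := eqVneq e' e; last first.
  rewrite /= addr0; apply: (slope_le_pt rt hs ltr01) => s _ /= hs'.
  by rewrite !tent_fun_pt // (negbTE ne) mul0r addr0.
subst e'; case: d hp hs => hp hs /=; rewrite ?andbF ?andbT /= ?addr0 ?add0r.
  have [tb|tb|tb] := ltgtP t b.
  - have ta : t <= a by rewrite leNgt; apply/negP => at_; have := hout t; rewrite at_ tb eqxx => /(_ isT).
    apply: le_trans (_ : 0 <= _); last by case: ifP.
    apply: (slope_le_pt rt hs ltr01) => s /andP[s0 _] /= hs'.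
    rewrite !tent_fun_pt // eqxx mul0r addr0 tent_le_a; last by lra.
    by rewrite tent_le_a.
  - apply: le_trans (_ : 0 <= _); last by case: ifP.
    apply: (slope_le_pt rt hs (_ : 0 < t - b)); first by rewrite subr_gt0.
    move=> s /andP[s0 sb] /= hs'; rewrite !tent_fun_pt // eqxx mul0r addr0.
    by rewrite !tent_ge_b //; lra.
  - subst t; rewrite eqxx; apply: (slope_le_pt rt hs (_ : 0 < b - c)); first by rewrite subr_gt0.
    move=> s /andP[s0 sb] /= hs'; rewrite !tent_fun_pt // eqxx.
    by rewrite (tent_ge_b (lexx b)) tent_cb -?pmulrn; lra.
have [ta|ta|ta] := ltgtP t a.
- apply: le_trans (_ : 0 <= _); last by case: ifP.
  apply: (slope_le_pt rt hs (_ : 0 < a - t)); first by rewrite subr_gt0.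
  move=> s /andP[s0 sb] /= hs'; rewrite !tent_fun_pt // eqxx mul0r addr0.
  by rewrite !tent_le_a //; lra.
- have tb : b <= t by rewrite leNgt; apply/negP => at_; have := hout t; rewrite at_ ta eqxx => /(_ isT).
  apply: le_trans (_ : 0 <= _); last by case: ifP.
  apply: (slope_le_pt rt hs ltr01) => s /andP[s0 _] /= hs'.
  rewrite !tent_fun_pt // eqxx mul0r addr0 tent_ge_b; last by lra.
  by rewrite tent_ge_b.
subst t; rewrite eqxx; apply: (slope_le_pt rt hs (_ : 0 < c - a)); first by rewrite subr_gt0.
move=> s /andP[s0 sb] /= hs'; rewrite !tent_fun_pt // eqxx.
by rewrite (tent_le_a (lexx a)) tent_ac -?pmulrn; lra.
Qed.

Lemma sum_if_eq_le p (h0 : edge G * bool) (b0 : bool) (m : nat) :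
  \sum_(h in tangent p) (if (h == h0) && b0 then m%:Z else 0) <= m%:Z * b0%:R.
Proof.
case: b0; last by rewrite big1 ?mulr0 // => h _; rewrite andbF.
rewrite mulr1 (eq_bigr (fun h => if h == h0 then m%:Z else 0)); last by move=> h _; rewrite andbT.
rewrite -big_mkcondr /=.
apply: le_trans (_ : \sum_(h | h == h0) m%:Z <= _); last by rewrite big_pred1_eq.
rewrite big_mkcond [leRHS]big_mkcond /=; apply: ler_sum => h _.
by case: (_ == _); rewrite ?andbF // andbT; case: ifP.
Qed.

(** The coefficients are computed at the peak and only bounded below the divisor of the tent
    elsewhere; both sides of the inequality have degree 0, so it is an equality. This covers feet
    that are vertices, of any valence. *)
Lemma tent_equiv : lin_equiv (<< i%:Z *g pt e a >> + << j%:Z *g pt e b >>)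
  << (i + j)%:Z *g pt e c >>.
Proof.
have rt := tent_fun_rational; have [P dP hP] := principalP rt.
set Q := << i%:Z *g pt e a >> + << j%:Z *g pt e b >>.
have hc : 0 < c < len e by rewrite (le_lt_trans a0) // (lt_le_trans cb).
have bound p : coeff p (<< (i + j)%:Z *g pt e c >> - Q) <= coeff p P.
  rewrite hP coeffB !coeffD !coeffU.
  have [Ep|pc] := eqVneq (pt e c) p.
    have -> : ord tent_fun p = (i + j)%:Z.
      rewrite -Ep ord_inner //.
      have sR : slope tent_fun (pt e c) (e, false) = - j%:Z.
        apply: (@slope_affineR _ _ _ _ _ b _ (j%:R * b)) => // [|t /andP[ct tb]].
          by case/andP: hc => /ltW.
        rewrite tent_fun_pt; last by case/andP: hc => hc _; rewrite (le_trans (ltW hc)) // (le_trans tb).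
        by rewrite eqxx tent_cb ?ct // rmorphN /= -pmulrn; ring.
      have sL : slope tent_fun (pt e c) (e, true) = - i%:Z.
        apply: (@slope_affineL _ _ _ _ a _ _ (- (i%:R * a))) => // [|t /andP[ct tb]].
          by case/andP: hc => _ /ltW.
        rewrite tent_fun_pt; last by case/andP: hc => _ hc; rewrite (le_trans a0) // (le_trans tb) // ltW.
        by rewrite eqxx tent_ac ?ct // -pmulrn; ring.
      by rewrite sR sL PoszD; ring.
    by rewrite mulr1 gerBl addr_ge0 // mulr_ge0.
  rewrite mulr0 sub0r lerNl; have [[t ht Et]|hout] := pselect (exists2 t, a < t < b & p = pt e t).
    apply: le_trans (_ : 0 <= _); last by rewrite addr_ge0 // mulr_ge0.
    rewrite oppr_le0 Et; case/andP: ht => at_ tb.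
    have [tc|ct|tc] := ltgtP t c; last by move: pc; rewrite Et tc eqxx.
      rewrite (@ord_affine _ _ _ e a c) ?at_ ?(ltW (lt_le_trans cb bl)) //.
      exists i%:Z, (- (i%:R * a)) => w /andP[aw wc]; rewrite tent_fun_pt ?eqxx; last first.
        by rewrite (le_trans a0 aw) (le_trans wc) // ltW // (lt_le_trans cb).
      by rewrite tent_ac ?aw // -pmulrn; ring.
    rewrite (@ord_affine _ _ _ e c b) ?ct ?(ltW (le_lt_trans a0 ac)) //.
    exists (- j%:Z), (j%:R * b) => w /andP[cw wb]; rewrite tent_fun_pt ?eqxx; last first.
      by rewrite (le_trans _ cw) ?(ltW (le_lt_trans a0 ac)) // (le_trans wb).
    by rewrite tent_cb ?cw // rmorphN /= -pmulrn; ring.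
  rewrite /ord opprK.
  apply: le_trans (_ : \sum_(h in tangent p)
      ((if (h == (e, false)) && (p == pt e a) then i%:Z else 0) +
       (if (h == (e, true)) && (p == pt e b) then j%:Z else 0)) <= _).
    apply: ler_sum => h hp; apply: slope_tent_fun hp _ => t ht.
    by apply/eqP => Et; apply: hout; exists t.
  by rewrite big_split (eq_sym (pt e a)) (eq_sym (pt e b)) /= lerD ?sum_if_eq_le.
have E : P = << (i + j)%:Z *g pt e c >> - Q.
  apply/eqP; rewrite -subr_eq0; apply/eqP/fgpos_eq0P.
    by apply/fgposP => p; rewrite coeffB subr_ge0.
  by rewrite !degB dP !degD !degU PoszD; ring.
apply: lin_equiv_sym; exists tent_fun => // p.
by rewrite -hP E.
Qed.

End Tent.
End Isolated.

(** * Isolated points of the Weierstrass locus *)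

Section IsolatedWeight.
Context {R : realType} {G : tropicalCurve R}.
Implicit Types (p q x : tpoint G) (D E F : divisor G) (e : edge G) (a b c t : R).

Definition along (h : edge G * bool) t (s : R) : tpoint G :=
  pt h.1 (if h.2 then t - s else t + s).

Lemma pt_inner_neq e c t : 0 < c < len e -> c != t -> pt e c != pt e t.
Proof.
move=> hc; apply: contra_neq => E; have [ht|ht] := boolP (0 < t < len e).
  by have [_] := pt_inj_inner hc ht E.
by move: E; rewrite (ptE ht); have [u -> _] := pt_innerE hc.
Qed.

(** A tent with feet at distances 0 and (r + 1) s and peak at distance s: the slopes r and 1 are
    balanced, both sides having height r s. The bound [eta] keeps the far foot on the edge. *)
Lemma tent_along (h : edge G * bool) t (r : nat) : starts h t -> (0 < r)%N ->
  exists2 eta, 0 < eta & forall s, 0 < s < eta ->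
    [/\ lin_equiv (<< r%:Z *g pt h.1 t >> + << along h t (r.+1%:R * s) >>)
          << r.+1%:Z *g along h t s >>,
        along h t s != pt h.1 t, along h t (r.+1%:R * s) != pt h.1 t &
        pdist (pt h.1 t) (along h t s) <= s].
Proof.
move=> hs r0; pose l := if h.2 then t else len h.1 - t.
have l0 : 0 < l.
  by move: hs; rewrite /l /starts; case: h.2 => /andP[h1 h2] //; rewrite subr_gt0.
have r1 : 0 < r.+1%:R :> R by rewrite ltr0n.
have r2 : 0 < r%:R :> R by rewrite ltr0n.
exists (l / r.+1%:R); first by rewrite divr_gt0.
move=> s /andP[s0]; rewrite ltr_pdivlMr // mulrC => sl.
have rs : s < r.+1%:R * s by rewrite ltr_pMl // ltr1n.
have rsE : r.+1%:R * s = r%:R * s + s by rewrite -addn1 natrD mulrDl mul1r.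
have rs0 : 0 < r%:R * s by rewrite mulr_gt0.
case: h @l hs l0 sl => e [] l; rewrite /l {l} /starts /along /= => /andP[h1 h2] l0 sl.
  split.
  - rewrite (addrC << r%:Z *g _ >>); apply: (@tent_equiv _ _ e _ _ _ 1 r);
      rewrite // rsE in sl *; lra.
  - by apply: pt_inner_neq; [apply/andP; split | apply/eqP]; lra.
  - by apply: pt_inner_neq; [apply/andP; split | apply/eqP]; lra.
  apply: pdist_le; rewrite -[X in path_length _ _ X](_ : `|t - (t - s)| = s).
    by apply: path_length1; apply/andP; split; lra.
  by rewrite subKr gtr0_norm.
split.
- rewrite -addn1; apply: (@tent_equiv _ _ e _ _ _ r 1);
    rewrite // ?addn1 ?rsE; lra.
- by apply: pt_inner_neq; [apply/andP; split | apply/eqP]; lra.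
- by apply: pt_inner_neq; [apply/andP; split | apply/eqP]; lra.
apply: pdist_le; rewrite -[X in path_length _ _ X](_ : `|t - (t + s)| = s).
  by apply: path_length1; apply/andP; split; lra.
by rewrite opprD addNKr normrN gtr0_norm.
Qed.

Lemma starts_exists p : exists h t, starts h t /\ p = pt h.1 t.
Proof.
have [e [t [/andP[t0 tl] ->]]] := pt_surj p; have [t1|t1] := ltP t (len e).
  by exists (e, false), t; rewrite /starts /= t0.
by exists (e, true), t; rewrite /starts /= tl (lt_le_trans (len_gt0 e)).
Qed.

Lemma isolated_rank D p (r : nat) : rank D = r%:Z -> isolated (WL D) p ->
  rank (D - << r%:Z *g p >>) <= 0.
Proof.
case: r => [|r] rD; first by rewrite freegU0 subr0 rD.
move=> /isolatedP[pW [eps eps0 hiso]]; rewrite leNgt; apply/negP => rk.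
have {rk} rk : rank_ge (D - << r.+1%:Z *g p >>) 1 by apply/rank_geP.
have [h [t [hs ep]]] := starts_exists p; subst p.
have [eta eta0 heta] := tent_along hs (ltn0Sn r).
pose s := Num.min eps eta / 2.
have m0 : 0 < Num.min eps eta by rewrite lt_min eps0.
have [m1 m2] : Num.min eps eta <= eps /\ Num.min eps eta <= eta.
  by rewrite !ge_min !lexx orbT.
have [|le1 /eqP ne1 _ di] := heta s; first by apply/andP; rewrite /s; split; lra.
apply: ne1; apply: hiso; first by apply: le_lt_trans di _; rewrite /s; lra.
rewrite /WL /= rD; apply/(@rank_geP _ _ _ 0)/rank_ge0E.
have -> : r.+1%:Z + 1 = r.+2%:Z by rewrite -(addn1 r.+1) PoszD.
have := rk [tuple along h t (r.+2%:R * s)]; rewrite big_seq1; apply: eff_equiv_lin.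
rewrite -addrA -opprD; apply: lin_equivD; first exact: lin_equiv_refl.
exact/lin_equivN/lin_equiv_sym.
Qed.

Lemma isolated_weight_le D p : 0 <= rank D -> isolated (WL D) p ->
  weight D p <= deg D - rank D.
Proof.
case E : (rank D) => [r|//] _ iso.
have [N [-> h _]] := weightE E (isolated_rank E iso).
have := rank_le_deg (k := 0) h; rewrite degB degU; lia.
Qed.

(* Conversely, the tent moves D - (r + 1)(q) with q near p to D - r (p) - (x) with
   x near p. *)
Lemma isolated_of_not_eff D p (r : nat) : rank D = r%:Z -> (0 < r)%N -> WL D p ->
  (exists2 eps, 0 < eps & forall q, pdist p q < eps -> q != p ->
     exists h t s, [/\ starts h t, p = pt h.1 t, q = along h t s & 0 < s <= pdist p q]) ->
  (exists2 eta, 0 < eta & forall h t s, starts h t -> p = pt h.1 t -> 0 < s < eta ->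
     ~ eff_equiv (D - << r%:Z *g p >> - << along h t s >>)) ->
  isolated (WL D) p.
Proof.
move=> rD r0 pW [eps eps0 heps] [eta eta0 heta]; apply/isolatedP; split=> //.
(* A tent radius for each half-edge, with the dummy value 1 for those not starting at [p];
   finiteness then gives a common radius. *)
have near_h h : exists eta', 0 < eta' /\ forall t s, starts h t -> p = pt h.1 t ->
    0 < s < eta' -> lin_equiv (<< r%:Z *g p >> + << along h t (r.+1%:R * s) >>)
          << r.+1%:Z *g along h t s >>.
  have [[t [ht ep]]|hno] := pselect (exists t, starts h t /\ p = pt h.1 t); last first.
    by exists 1; split=> // t s ht ep _; case: hno; exists t.
  have [eta' eta'0 h'] := tent_along ht r0; exists eta'; split=> // t' s ht' ep' hs.
  have -> : t' = t.
    by rewrite -(starts_pt ht).2 -(starts_pt ht').2 -ep -ep'.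
  by rewrite {1}ep; have [] := h' s hs.
have /choice[w hw] := near_h.
have [|eps1 eps10 heps1] := @pos_lower_bound R _ (enum {: edge G * bool}) w.
  by move=> h _; exact: (hw h).1.
have r1 : 0 < r.+1%:R :> R by rewrite ltr0n.
have e0 : 0 < eta / r.+1%:R by rewrite divr_gt0.
exists (Num.min eps (Num.min eps1 (eta / r.+1%:R))).
  by rewrite !lt_min eps0 eps10.
move=> q; rewrite !lt_min => /and3P[q1 q2 q3] qW; apply/eqP/negPn/negP => qp.
have [h [t [s [hs ep eq_q /andP[s0 sd]]]]] := heps q q1 qp.
have s1 : s < w h by apply: le_lt_trans sd (lt_le_trans q2 (heps1 h (mem_enum _ _))).
have le1 := (hw h).2 t s hs ep; rewrite s0 s1 in le1; have {}le1 := le1 isT.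
apply: (heta h t (r.+1%:R * s) hs ep).
  rewrite mulr_gt0 //= mulrC -ltr_pdivlMr //; exact: le_lt_trans sd q3.
move: qW; rewrite /WL /= rD => /(@rank_geP _ _ _ 0)/rank_ge0E.
have -> : r%:Z + 1 = r.+1%:Z by rewrite -(addn1 r) PoszD.
apply: eff_equiv_lin; rewrite -addrA -opprD eq_q.
by apply: lin_equivD; [exact: lin_equiv_refl | exact: lin_equivN].
Qed.

End IsolatedWeight.

(** * The extremal curves *)

Section Spokes.
Context {R : realType}.
Variables n k : nat.

(* The center false is joined to the hub true by n + 1 edges of length 1, and k
   loops of length 1 are attached to the hub. *)
Definition spokes_src (e : 'I_n.+1 + 'I_k) : bool := if e is inl _ then false else true.

Fact spokes_len_gt0 (e : 'I_n.+1 + 'I_k) : 0 < 1 :> R.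
Proof. exact: ltr01. Qed.

Fact spokes_vertex_gt0 : (0 < #|{: bool}|)%N.
Proof. by rewrite card_bool. Qed.

Fact spokes_incident (v : bool) :
  exists e : 'I_n.+1 + 'I_k, (spokes_src e == v) || (true == v).
Proof. by exists (inl ord0); case: v. Qed.

Fact spokes_connected (u v : bool) :
  connect (fun u v => [exists e : 'I_n.+1 + 'I_k,
    ((spokes_src e == u) && (true == v)) || ((spokes_src e == v) && (true == u))]) u v.
Proof.
have adj_neq (x y : bool) : x != y -> [exists e : 'I_n.+1 + 'I_k,
    ((spokes_src e == x) && (true == y)) || ((spokes_src e == y) && (true == x))].
  by move=> xy; apply/existsP; exists (inl ord0); case: x y xy => -[].
by have [->|uv] := eqVneq u v; [exact: connect0 | apply/connect1/adj_neq].
Qed.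

Definition spokes : tropicalCurve R :=
  @TropicalCurve R bool ('I_n.+1 + 'I_k)%type spokes_src (fun=> true) (fun=> 1)
    spokes_len_gt0 spokes_vertex_gt0 spokes_incident spokes_connected.

Notation G := spokes.
Implicit Types (p q x : tpoint G) (D : divisor G) (e : edge G) (s t : R).

Definition center : tpoint G := inl (false : vertex G).
Definition hub : tpoint G := inl (true : vertex G).

Lemma genus_spokes : genus G = (n + k)%N.
Proof. by have := @genusE R G; rewrite /= card_bool card_sum !card_ord; lia. Qed.

Lemma pt0 e : pt e 0 = inl (spokes_src e).
Proof. exact: (pt_src e). Qed.

Lemma pt1 e : pt e 1 = hub.
Proof. exact: (pt_tgt e). Qed.

(** It serves twice: being 1-Lipschitz, it shows that points close to [center] lie on spokes; and
    its divisor relates the canonical divisor to a multiple of [center]. *)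
Definition height p : R :=
  match p with
  | inl v => if v then 1 else 0
  | inr y => if tag y is inl _ then val (tagged y) else 1
  end.

Lemma height_pt e t : 0 <= t <= 1 -> height (pt e t) = if e is inl _ then t else 1.
Proof.
move=> /andP[t0 t1]; have [ht|ht] := boolP (0 < t < len e).
  by have [u -> <-] := pt_innerE ht; case: e u {ht}.
rewrite (ptE ht) /=; move: ht; rewrite negb_and -!leNgt => /orP[h|h].
  have -> : t = 0 by apply/le_anti; rewrite h.
  by rewrite lexx; case: e.
have -> : t = 1 by apply/le_anti; rewrite h t1.
by rewrite ler10; case: e {h}.
Qed.

Lemma height_affine e : int_affine (fun t => height (pt e t)) 0 (len e).
Proof.
case: e => i; [exists 1, 0 | exists 0, 1] => t ht; rewrite height_pt //.
  by rewrite mul1r addr0.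
by rewrite mul0r add0r.
Qed.

Lemma height_rational : rational_function height.
Proof. by apply/rational_functionP => e; apply/int_affine_pl/height_affine. Qed.

Lemma height_lip p q : `|height p - height q| <= pdist p q.
Proof.
apply: lip_pdist => e s t hs ht; rewrite !height_pt //.
by case: e {hs ht} => // _; rewrite subrr normr0.
Qed.

Lemma height_center : height center = 0. Proof. by []. Qed.

Lemma near_center q : pdist center q < 1 -> q != center ->
  exists i s, [/\ q = pt (inl i : edge G) s, 0 < s < 1 & s <= pdist center q].
Proof.
move=> q1 qc; have := height_lip center q; rewrite height_center sub0r normrN.
case: q q1 qc => [[]|[[i|j] u]] q1 qc /=; rewrite ?normr1.
- by move=> /le_lt_trans/(_ q1); rewrite ltxx.
- by move: qc; rewrite eqxx.
- move=> h; have := valP u => /= hu; exists i, (val u); split=> //.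
    by rewrite -(pt_inner u).
  by apply: le_trans h; exact: ler_norm.
by move=> /le_lt_trans/(_ q1); rewrite ltxx.
Qed.

Lemma starts_center h t : starts h t -> center = pt h.1 t ->
  exists i, h = (inl i, false) /\ t = 0.
Proof.
case: h => e b; rewrite /starts /= => hs E.
have ht : ~~ (0 < t < len e).
  by apply/negP => ht; move: E; have [u -> _] := pt_innerE ht.
move: E; rewrite (ptE ht) => -[]; move: ht; rewrite negb_and -!leNgt.
case: b hs => /andP[h1 h2]; first by rewrite leNgt h1.
rewrite [(1 : R) <= t]leNgt h2 orbF => h3; rewrite h3.
by case: e {h2} => // i _; exists i; split=> //; apply/le_anti; rewrite h3.
Qed.

(** The divisor is bounded above by a moderator, so an effective representative would give one for
    the moderator. *)
Lemma center_not_eff (i : 'I_n.+1) s : 0 < s < 1 ->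
  ~ eff_equiv (<< n%:Z *g center >> - << pt (inl i : edge G) s >>).
Proof.
move=> hs; set x := pt _ s; pose e0 : edge G := inl i.
pose d (e : edge G) : seq R := if e == e0 then [:: s] else [::].
have hd : is_model d.
  by move=> e; rewrite /d /cut_list; case: ifP => _ /=; rewrite ?ltr01 ?andbT.
have [u xE _] := pt_innerE (hs : 0 < s < len e0).
(* In the order x, hub, center, all n + 1 spokes enter the center from earlier points, which gives
   n; nothing enters [x], which gives -1; and the segment from [x] keeps the hub coefficient
   nonnegative. *)
pose tau p : int := if p == x then 0 else if p == hub then 1 else 2.
have hub_x : (hub == x) = false by rewrite /x xE.
have center_x : (center == x) = false by rewrite /x xE.
have center_hub : (center == hub) = false by [].
have tau_x : tau x = 0 by rewrite /tau eqxx.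
have tau_hub : tau hub = 1 by rewrite /tau hub_x eqxx.
have tau_center : tau center = 2 by rewrite /tau center_x center_hub.
pose T B v e (ab : R * R) : int :=
  ((pt e ab.1 == v) && B (pt e ab.2))%:Z + ((pt e ab.2 == v) && B (pt e ab.1))%:Z.
have T0 B v e ab : 0 <= T B v e ab by [].
move=> heff; apply: (@moderator_not_eff _ _ d tau hd).
have [E0 eE0 E0E] : exists2 E0, effective E0 &
    moderator d tau = << n%:Z *g center >> - << x >> + E0.
  exists (moderator d tau - (<< n%:Z *g center >> - << x >>)); last first.
    by apply: divisorP => y; rewrite !(coeffD, coeffN); ring.
  move=> p; rewrite coeffB subr_ge0 coeff_moderator // coeffB !coeffU mul1r.
  have [Ep|pc] := eqVneq center p.
    rewrite -Ep inl_points (eq_sym x) center_x subr0 mulr1 tau_center.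
    rewrite lerBrDr; apply: le_trans (_ : \sum_(i < n.+1) 1 <= _).
      by rewrite sumr_const card_ord; lia.
    rewrite /nflags big_sumType /= -[leLHS]addr0; apply: lerD; last first.
      by rewrite sumr_ge0 // => j _; rewrite sumr_ge0.
    apply: ler_sum => j _.
    have [b hb tb] : exists2 b, (0, b) \in segments d (inl j : edge G) & tau (pt (inl j : edge G) b) < 2.
      rewrite /segments /d; case: eqP => [->|_]; [exists s | exists 1].
      - exact: mem_head.
      - by rewrite -/x tau_x.
      - exact: mem_head.
      - by rewrite pt1 tau_hub.
    rewrite (big_rem _ hb) /= pt0 eqxx tb -addrA lerDl addr_ge0 // sumr_ge0 //.
  rewrite mulr0 sub0r; case: ifPn => pd; last by rewrite oppr_le0 ler0n.
  have [Ep|px] := eqVneq x p; first by rewrite lerBrDr addNr nflags_ge0.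
  rewrite oppr0 subr_ge0; have Ep : p = hub.
    move: pd; rewrite mem_cat => /orP[/mapP[[] _ Ep]|].
    - exact: Ep.
    - by move: pc; rewrite Ep eqxx.
    move=> /allpairsPdep[e [t [_]]]; rewrite /d; case: eqP => // -> .
    by rewrite inE => /eqP -> Ep; move: px; rewrite Ep eqxx.
  have hb : (s, 1) \in segments d e0 by rewrite /segments /d eqxx !inE eqxx orbT.
  apply: le_trans (sum_segments_ge (T := T (fun u => tau u < tau p) p) _ hb) => //.
  by rewrite /T /= pt1 -/x Ep eqxx tau_hub tau_x /=; lia.
by rewrite E0E; apply: eff_equivD.
Qed.

Lemma rank_center : rank << n%:Z *g center >> <= 0.
Proof.
rewrite leNgt; apply/negP => h.
have {h} h : rank_ge << n%:Z *g center >> 1 by apply/rank_geP.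
apply: (@center_not_eff ord0 (1 / 2)); first by apply/andP; split; lra.
by have := h [tuple pt (inl ord0 : edge G) (1 / 2)]; rewrite big_seq1.
Qed.

Lemma spokes_isolated D (N : nat) : (0 < n)%N -> (n < N)%N ->
  lin_equiv D << N%:Z *g center >> -> rank_ge D (N - n) ->
  [/\ 0 <= rank D, isolated (WL D) center & weight D center = n%:Z].
Proof.
move=> n0 nN hD hr; set r := (N - n)%N in hr.
have Dm (m : nat) : (m <= N)%N -> lin_equiv (D - << m%:Z *g center >>) << (N - m)%:Z *g center >>.
  move=> mN; have -> : << (N - m)%:Z *g center >> = << N%:Z *g center >> - << m%:Z *g center >>.
    by rewrite freegUB subzn.
  exact: lin_equiv_addr.
have Nr : (N - r)%N = n by rewrite /r subKn // ltnW.
have rN : (r <= N)%N by exact: leq_subr.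
have hr0 : rank (D - << r%:Z *g center >>) <= 0.
  by rewrite (rank_lin (Dm r rN)) Nr rank_center.
have rD : rank D = r%:Z.
  apply/le_anti/andP; split; last exact/rank_geP.
  by have := rank_subn_ge D center r; move: hr0; lia.
have r0 : (0 < r)%N by rewrite subn_gt0.
split; first by rewrite rD.
  apply: (isolated_of_not_eff rD r0).
  - rewrite /WL /= rD; have -> : r%:Z + 1 = r.+1%:Z by rewrite -(addn1 r) PoszD.
    have rN' : (r < N)%N by rewrite /r ltn_subrL n0 (ltn_trans n0).
    apply/(@rank_geP _ _ _ 0)/rank_ge0E; apply: eff_equiv_lin (Dm _ rN') _.
    by exists << (N - r.+1)%:Z *g center >>; [exact: effectiveU | exact: lin_equiv_refl].
  - exists 1 => // q q1 qc; have [i [s [-> hs sd]]] := near_center q1 qc.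
    exists (inl i, false), 0, s; split=> //.
    + by rewrite /starts /= lexx ltr01.
    + by rewrite pt0.
    + by rewrite /along /= add0r.
    by case/andP: hs => ->.
  exists 1 => // h t s hst E hs; have [i [-> ->]] := starts_center hst E.
  rewrite /along /= add0r => heff; apply: (@center_not_eff i s hs).
  have := Dm r rN; rewrite Nr => /lin_equiv_sym hDr.
  by apply: eff_equiv_lin heff; apply: lin_equiv_addr.
have [M [-> h1 h2]] := weightE rD hr0.
have dD : deg D = N%:Z by rewrite (lin_equiv_deg hD) degU.
have := rank_le_deg (k := 0) h1; rewrite degB degU dD => h3.
have M0 : (0 < M)%N.
  rewrite lt0n; apply/eqP => M0; move: h2; rewrite M0 freegU0 subr0 rD; lia.
have NM : (N < M)%N.
  rewrite ltnNge; apply/negP => MN; move: h2; rewrite ltNge => /negP; apply.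
  apply/(@rank_geP _ _ _ 0)/rank_ge0E; apply: eff_equiv_lin (Dm _ MN) _.
  by exists << (N - M)%:Z *g center >>; [exact: effectiveU | exact: lin_equiv_refl].
by move: h3 NM Nr; rewrite /r; lia.
Qed.

Lemma sum_tangent_vertex (v : bool) (F : edge G * bool -> int) :
  \sum_(h in tangent (inl v : tpoint G)) F h =
  \sum_(i < n.+1) F (inl i, v) + (if v then \sum_(j < k) (F (inr j, false) + F (inr j, true)) else 0).
Proof.
have hd : is_model (fun _ : edge G => [::]) by move=> e; rewrite /cut_list /= ltr01.
rewrite (sum_tangent (fun=> F) hd (inl_points _ _)) big_sumType /=.
congr (_ + _); last first.
  case: v; last first.
    by rewrite big1 // => j _; rewrite big_seq1 /= pt0 pt1.
  by apply: eq_bigr => j _; rewrite big_seq1 /= pt0 pt1 !eqxx.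
apply: eq_bigr => i _; rewrite big_seq1 /= pt0 pt1 /=.
by case: v; rewrite !eqxx /= ?addr0 ?add0r.
Qed.

Lemma slope_height (h : edge G * bool) :
  slope height (pt h.1 (if h.2 then 1 else 0)) h =
    if h.1 is inl _ then (if h.2 then -1 else 1) else 0.
Proof.
have l1 e : (1 : R) <= len e by [].
case: h => -[i|j] [] /=.
- apply: (@slope_affineL _ _ _ _ 0 1 1 0) => // t ht.
  by rewrite height_pt // mul1r addr0.
- apply: (@slope_affineR _ _ _ _ 0 1 1 0) => // t ht.
  by rewrite height_pt // mul1r addr0.
- rewrite -oppr0; apply: (@slope_affineL _ _ _ _ 0 1 0 1) => // t ht.
  by rewrite height_pt // mul0r add0r.
- apply: (@slope_affineR _ _ _ _ 0 1 0 1) => // t ht.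
  by rewrite height_pt // mul0r add0r.
Qed.

(** With one loop, K has n + 1 chips at the hub and n - 1 at the center; [height] sends the former
    down the n + 1 spokes. *)
Lemma canonical_spokes : k = 1%N -> lin_equiv (canonical G) << (2 * n)%:Z *g center >>.
Proof.
move=> k1; exists height => [|p]; first exact: height_rational.
rewrite coeffB coeff_canonical coeffU; case: p => [v|[e u]]; last first.
  rewrite -pt_inner (ord_affine (lexx 0) (lexx _) (valP u) (height_affine e)).
  by rewrite (valence_inner (valP u)) pt_inner mulr0 !subrr.
have -> : (valence (inl v : tpoint G))%:Z = \sum_(h in tangent (inl v : tpoint G)) 1%:Z.
  by rewrite sumr_const /valence natz.
rewrite /ord !sum_tangent_vertex sumr_const card_ord.
have slE (h : edge G * bool) : inl v = pt h.1 (if h.2 then 1 else 0) ->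
    slope height (inl v) h = if h.1 is inl _ then (if h.2 then -1 else 1) else 0.
  by move=> ->; exact: slope_height.
case: v slE => slE.
  have -> : \sum_(i < n.+1) slope height (inl true) (inl i, true) = - n.+1%:Z.
    rewrite (eq_bigr (fun=> -1)) => [|i _]; first by rewrite sumr_const card_ord; lia.
    by apply: (slE (inl i, true)); rewrite /= pt1.
  rewrite [X in _ = - (_ + X)]big1 => [|j _]; last first.
    have -> : slope height (inl true) (inr j, false) = 0.
      by apply: (slE (inr j, false)); rewrite /= pt0.
    by rewrite add0r; apply: (slE (inr j, true)); rewrite /= pt1.
  rewrite sumr_const card_ord k1 (_ : center == _ = false) //; lia.
have -> : \sum_(i < n.+1) slope height (inl false) (inl i, false) = n.+1%:Z.
  rewrite (eq_bigr (fun=> 1)) => [|i _]; first by rewrite sumr_const card_ord; lia.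
  by apply: (slE (inl i, false)); rewrite /= pt0.
rewrite (_ : center == _ = true) // ?eqxx //; lia.
Qed.

End Spokes.

Theorem corollary1p2 (R : realType) (g : nat) (hg : (2 <= g)%N) :
  (forall (G : tropicalCurve R) (D : divisor G) (p : tpoint G),
     genus G = g -> 0 <= rank D -> isolated (WL D) p ->
     (D = canonical G -> weight D p <= g%:Z - 1) /\
     (deg D > 2 * g%:Z - 2 -> weight D p <= g%:Z)) /\
  (exists (G : tropicalCurve R) (p : tpoint G),
     [/\ genus G = g, isolated (WL (canonical G)) p &
         weight (canonical G) p = g%:Z - 1]) /\
  (forall d : int, d > 2 * g%:Z - 2 ->
     exists (G : tropicalCurve R) (D : divisor G) (p : tpoint G),
       [/\ genus G = g, deg D = d, 0 <= rank D, isolated (WL D) p &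
           weight D p = g%:Z]).
Proof.
split=> [G D p gE rD iso|]; last split.
- have hw := isolated_weight_le rD iso; split=> [DK|hd].
    have : g.-1%:Z <= rank D by rewrite DK -gE; apply/rank_geP/canonical_rank_ge; rewrite gE.
    by move: hw; rewrite {2}DK deg_canonical gE; lia.
  (* As g >= 2, deg D > 2g - 2 >= g, so the absolute value is deg D - g itself. *)
  have : `|deg D - g%:Z|%N%:Z <= rank D.
    by apply/rank_geP/riemann_rank_ge; rewrite gE; lia.
  by move: hw; lia.
- have gS : genus (@spokes R g.-1 1) = g by rewrite genus_spokes; lia.
  exists (@spokes R g.-1 1), (@center R g.-1 1).
  (* N = 2g - 2 is the degree of K, and N - n = g - 1 is its rank bound. *)
  have [||||_ iso ->] := @spokes_isolated R g.-1 1 (canonical _) (2 * g.-1).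
  + by lia.
  + by lia.
  + exact: canonical_spokes.
  + rewrite (_ : (2 * g.-1 - g.-1)%N = (genus (@spokes R g.-1 1)).-1); last by rewrite gS; lia.
    by apply: canonical_rank_ge; rewrite gS.
  by split=> //; lia.
- move=> d hd; have gS : genus (@spokes R g 0) = g by rewrite genus_spokes addn0.
  have dE : `|d|%N%:Z = d by lia.
  exists (@spokes R g 0), << d *g @center R g 0 >>, (@center R g 0).
  (* Here n = g < N = d because d > 2g - 2 >= g, and N - n = d - g is the Riemann bound. *)
  have [||||r0 iso ->] := @spokes_isolated R g 0 << d *g @center R g 0 >> `|d|%N.
  + by lia.
  + by lia.
  + by rewrite dE; exact: lin_equiv_refl.
  + by apply: riemann_rank_ge; rewrite gS degU; lia.
  by split=> //; rewrite degU.
Qed.
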